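(* Let $K$ be a field of characteristic $0$, let $A$ be a Cohen-Macaulay standard graded $K$-algebra of Krull dimension $d$, and let $\Theta=\theta_1,\dots,\theta_d$ be a linear system of parameters for $A$. Let $r\geq 1$ be an integer and $s=\left\lfloor \frac{(r-1)d}{r}\right\rfloor$. Then $A_\Theta^{\langle r\rangle}$ has the $s$-Lefschetz property. Moreover, if $r\geq \deg h_A(t)$, then $A_\Theta^{\langle r\rangle}$ is almost strong Lefschetz.
   Context: A standard graded $K$-algebra is a commutative graded $K$-algebra $A=\bigoplus_{i\ge 0}A_i$ with $A_0=K$ that is generated as a $K$-algebra by the finite-dimensional space $A_1$. Its Hilbert series $\mathrm{Hilb}(A,t)=\sum_{i\ge0}(\dim_K A_i)t^i$ has the form $(h_0+h_1t+\cdots+h_\sigma t^\sigma)/(1-t)^d$, where $d=\dim A$ is the Krull dimension and the $h_i$ are integers; the polynomial $h_A(t)=h_0+h_1t+\cdots+h_\sigma t^\sigma$ (with $h_\sigma\neq 0$) is the $h$-polynomial of $A$. For an integer $r\ge1$, the $r$th Veronese subalgebra is $A^{\langle r\rangle}=\bigoplus_{i\ge0}A_{ir}$, graded by $(A^{\langle r\rangle})_i=A_{ir}$. A linear system of parameters (l.s.o.p.) for $A$ with $\dim A=d$ is a sequence $\Theta=\theta_1,\dots,\theta_d\in A_1$ such that $\dim_K A/\Theta A<\infty$. For such $\Theta$, set $A_\Theta^{\langle r\rangle}:=A^{\langle r\rangle}/(\theta_1^rA^{\langle r\rangle}+\cdots+\theta_d^rA^{\langle r\rangle})$; this is a standard graded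 Artinian $K$-algebra with the induced grading. Let $B=\bigoplus_{i=0}^{\sigma}B_i$ be a standard graded Artinian $K$-algebra with $\dim_K B_\sigma>0$ (and $B_i=0$ for $i>\sigma$). For an integer $k\geq1$, $B$ has the $k$-Lefschetz property if there is a linear form $w\in B_1$ such that the multiplication map $B_i\to B_{k-i}$, $p\mapsto w^{k-2i}p$, is injective for all integers $0\le i\le\lfloor\frac{k-1}{2}\rfloor$. For $k\le 0$ there is no such $i$ and the $k$-Lefschetz property is regarded as (vacuously) satisfied. $B$ is called almost strong Lefschetz if it has the $(\sigma-1)$-Lefschetz property. *)

(* Defs.v *)
From HB Require Import structures.
From mathcomp Require Import all_boot all_order all_algebra.
From mathcomp Require Import generic_quotient ring_quotient.
From mathcomp Require Import boolp.

Set Implicit Arguments.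
Unset Strict Implicit.
Unset Printing Implicit Defensive.

Import GRing.Theory.
Local Open Scope ring_scope.

(* Decidable predicates {pred A} are used for subspaces, ideals, ...; with the
   classical axioms of boolp (via `[< P >]) they are exactly the subsets of A. *)

Section Sums.
Variable V : zmodType.

(* a lies in the sum of the P i, i >= 0 (meant for P i stable by sums) *)
Definition in_sum (P : nat -> {pred V}) (a : V) : Prop :=
  exists n (f : nat -> V), (forall i, f i \in P i) /\ a = \sum_(i < n) f i.

Lemma sum_trunc n m (f : nat -> V) : (n <= m)%N ->
  \sum_(i < n) f i = \sum_(i < m) (if (i < n)%N then f i else 0).
Proof.
move=> nm; rewrite (big_ord_widen m f nm) big_mkcond.
by apply: eq_bigr.
Qed.

Variable P : nat -> {pred V}.
Hypothesis P0 : forall i, 0 \in P i.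
Hypothesis PD : forall i, {in P i &, forall x y, x + y \in P i}.

Lemma in_sum1 i a : a \in P i -> in_sum P a.
Proof.
move=> Pa; exists i.+1, (fun j => if j == i then a else 0); split.
  by move=> j; case: eqP => [->|].
rewrite big_ord_recr /= eqxx big1 ?add0r // => j _.
by rewrite ltn_eqF.
Qed.

Lemma in_sum0 : in_sum P 0.
Proof. exact: (@in_sum1 0%N). Qed.

Lemma in_sumD a b : in_sum P a -> in_sum P b -> in_sum P (a + b).
Proof.
move=> [n [f [Pf ->]]] [m [g [Pg ->]]].
rewrite (sum_trunc f (leq_maxl n m)) (sum_trunc g (leq_maxr n m)).
exists (maxn n m), (fun i => (if (i < n)%N then f i else 0)
                           + (if (i < m)%N then g i else 0)); split.
  by move=> i; apply: PD; case: ifP.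
by rewrite big_split.
Qed.

Lemma in_sum_sum I (r : seq I) (Q : pred I) (F : I -> V) :
  (forall i, Q i -> in_sum P (F i)) -> in_sum P (\sum_(i <- r | Q i) F i).
Proof. by move=> PF; apply: big_ind => //; [apply: in_sum0|apply: in_sumD]. Qed.

End Sums.

Section Grading.
Variables (K : fieldType) (A : comAlgType K).

(* A is the (internal) direct sum of the subspaces A_ i, and this
   decomposition is compatible with the product *)
Record is_grading (A_ : nat -> {pred A}) : Prop := IsGrading {
  grading_sub : forall i, GRing.submod_closed (A_ i);
  grading_one : 1 \in A_ 0%N;
  grading_mul : forall i j a b, a \in A_ i -> b \in A_ j -> a * b \in A_ (i + j)%N;
  grading_span : forall a, in_sum A_ a;
  grading_free : forall n (f : nat -> A), (forall i, f i \in A_ i) ->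
    \sum_(i < n) f i = 0 -> forall i, (i < n)%N -> f i = 0 }.

End Grading.

Record gradedAlg (K : fieldType) := GradedAlg {
  galg :> comAlgType K;
  piece : nat -> {pred galg};
  pieceP : is_grading piece }.
Arguments piece {K} g i.
Arguments pieceP {K} g.

Definition has_dim (K : fieldType) (V : lmodType K) (U : {pred V}) (n : nat) : Prop :=
  exists b : 'I_n -> V, (forall i, b i \in U) /\
    forall u, u \in U -> exists! c : {ffun 'I_n -> K}, u = \sum_(i < n) c i *: b i.

Definition standard_graded (K : fieldType) (A : gradedAlg K) : Prop :=
  [/\ forall a, a \in piece A 0 -> exists c : K, a = c%:A,
      exists n, has_dim (piece A 1) n &
      forall S : {pred A}, GRing.subalg_closed S -> {subset piece A 1 <= S} ->
        forall a, a \in S].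

Section Ring.
Variable R : comNzRingType.
Implicit Types (I : {pred R}) (s : seq R).

Definition ideal_gen s : {pred R} := fun a =>
  `[< exists c : nat -> R, a = \sum_(i < size s) c i * s`_i >].

Definition prime_ideal I : Prop := idealr_closed I /\ prime_idealr_closed I.

Definition prime_chain n : Prop :=
  exists P : nat -> {pred R}, (forall i, (i <= n)%N -> prime_ideal (P i)) /\
    forall i, (i < n)%N -> {subset P i <= P i.+1} /\ ~ {subset P i.+1 <= P i}.

Definition krull_dim n : Prop :=
  prime_chain n /\ forall m, prime_chain m -> (m <= n)%N.

Definition regular_seq s : Prop :=
  1 \notin ideal_gen s /\
  forall i, (i < size s)%N -> forall a : R,
    s`_i * a \in ideal_gen (take i s) -> a \in ideal_gen (take i s).

End Ring.

Section Depth.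
Variables (K : fieldType) (A : gradedAlg K).

Definition homogeneous_regular_seq (s : seq A) : Prop :=
  (forall a, a \in s -> exists i, (0 < i)%N && (a \in piece A i)) /\ regular_seq s.

(* depth of A with respect to the irrelevant ideal: the maximal length of a
   regular sequence of homogeneous elements of positive degree *)
Definition graded_depth n : Prop :=
  (exists2 s, homogeneous_regular_seq s & size s = n) /\
  forall s, homogeneous_regular_seq s -> (size s <= n)%N.

Definition cohen_macaulay : Prop := exists2 n, krull_dim A n & graded_depth n.

(* Hilb(A,t) * (1-t)^d = h(t), as an identity between the coefficients of two
   formal power series *)
Definition is_h_polynomial (h : {poly int}) : Prop :=
  exists d (H : nat -> nat), [/\ krull_dim A d,
    forall i, has_dim (piece A i) (H i) &
    forall n, h`_n = \sum_(i < n.+1) (H i)%:Z * ((1 - 'X) ^+ d : {poly int})`_(n - i)].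

End Depth.

(* The quotient of a K-algebra by an ideal: the quotient ring is the one of
   ring_quotient, to which the K-module structure is added *)
Section AlgQuotient.
Variables (K : fieldType) (A : comAlgType K) (J : idealr A).
Local Open Scope quotient_scope.

Definition alg_quot : Type := {ideal_quot J}.
HB.instance Definition _ := GRing.ComNzRing.on alg_quot.

Definition qproj (a : A) : alg_quot := \pi_{ideal_quot J} a.

Lemma qproj_eq0 a : (qproj a == 0) = (a \in J).
Proof. by rewrite /qproj -[0 in LHS](rmorph0 (\pi_{ideal_quot J})) -Quotient.idealrBE subr0. Qed.

Lemma qproj_surj (x : alg_quot) : exists a, x = qproj a.
Proof. by exists (repr x); rewrite /qproj reprK. Qed.

Fact qproj_zmod : zmod_morphism qproj.
Proof. exact: (raddfB (\pi_{ideal_quot J})). Qed.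
Fact qproj_monoid : monoid_morphism qproj.
Proof. by split; [exact: (rmorph1 (\pi_{ideal_quot J}))
                 |exact: (rmorphM (\pi_{ideal_quot J}))]. Qed.
HB.instance Definition _ := GRing.isZmodMorphism.Build A alg_quot qproj qproj_zmod.
HB.instance Definition _ := GRing.isMonoidMorphism.Build A alg_quot qproj qproj_monoid.

Definition qscale (k : K) (x : alg_quot) : alg_quot := qproj (k%:A) * x.

Fact qscaleA a b x : qscale a (qscale b x) = qscale (a * b) x.
Proof. by rewrite /qscale mulrA -rmorphM /= -scalerAl mul1r scalerA. Qed.
Fact qscale1 : left_id 1 qscale.
Proof. by move=> x; rewrite /qscale scale1r rmorph1 mul1r. Qed.
Fact qscaleDr : right_distributive qscale +%R.
Proof. by move=> k x y; rewrite /qscale mulrDr. Qed.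
Fact qscaleDl x : {morph qscale^~ x : a b / a + b}.
Proof. by move=> a b; rewrite /qscale scalerDl rmorphD mulrDl. Qed.
HB.instance Definition _ := GRing.Zmodule_isLmodule.Build K alg_quot
  qscaleA qscale1 qscaleDr qscaleDl.

Fact qscaleAl (k : K) (x y : alg_quot) : k *: (x * y) = (k *: x) * y.
Proof. exact: mulrA. Qed.
HB.instance Definition _ := GRing.Lmodule_isLalgebra.Build K alg_quot qscaleAl.
HB.instance Definition _ := GRing.Lalgebra_isComAlgebra.Build K alg_quot.

Lemma qprojZ (k : K) (a : A) : qproj (k *: a) = k *: qproj a.
Proof. by rewrite -[a in LHS]mul1r scalerAl rmorphM. Qed.

End AlgQuotient.

Section Pieces.
Variables (K : fieldType) (A : gradedAlg K).

Lemma piece0 i : 0 \in piece A i.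
Proof. by case: (grading_sub (pieceP A) i). Qed.

Lemma pieceZD i (k : K) : {in piece A i &, forall x y, k *: x + y \in piece A i}.
Proof. by case: (grading_sub (pieceP A) i) => _; apply. Qed.

Lemma pieceD i : {in piece A i &, forall x y, x + y \in piece A i}.
Proof. by move=> x y Ax Ay; rewrite -[x]scale1r pieceZD. Qed.

Lemma pieceZ i (k : K) x : x \in piece A i -> k *: x \in piece A i.
Proof. by move=> Ax; rewrite -[_ *: _]addr0 pieceZD ?piece0. Qed.

Lemma pieceB i : {in piece A i &, forall x y, x - y \in piece A i}.
Proof. by move=> x y Ax Ay; rewrite addrC -scaleN1r pieceZD. Qed.

Lemma pieceX i n x : x \in piece A i -> x ^+ n \in piece A (i * n).
Proof.
move=> Ax; elim: n => [|n IHn]; first by rewrite muln0 (grading_one (pieceP A)).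
by rewrite exprS mulnS (grading_mul (pieceP A)).
Qed.

Lemma piece_uniq n m (f g : nat -> A) :
  (forall i, f i \in piece A i) -> (forall i, g i \in piece A i) ->
  \sum_(i < n) f i = \sum_(i < m) g i ->
  forall i, (if (i < n)%N then f i else 0) = (if (i < m)%N then g i else 0).
Proof.
move=> Af Ag; rewrite (sum_trunc f (leq_maxl n m)) (sum_trunc g (leq_maxr n m)).
move=> /eqP; rewrite -subr_eq0 -sumrB => /eqP fg0 i.
have [lt_i|le_i] := ltnP i (maxn n m); last first.
  by rewrite !ltnNge (leq_trans (leq_maxl n m) le_i) (leq_trans (leq_maxr n m) le_i).
apply/eqP; rewrite -subr_eq0; apply/eqP.
apply: (grading_free (pieceP A) (f := fun i =>
  (if (i < n)%N then f i else 0) - (if (i < m)%N then g i else 0)) _ fg0 lt_i).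
by move=> j; apply: pieceB; case: ifP; rewrite ?piece0.
Qed.

End Pieces.

(* degree one elements *)
Notation linear_form A := {x : galg A | x \in piece A 1}.

Section GradedQuotient.
Variables (K : fieldType) (A : gradedAlg K) (s : seq (linear_form A)).

Definition form_ideal : {pred A} := ideal_gen [seq val x | x <- s].

Let J_ i : {pred A} := [pred a | [&& a \in piece A i, a \in form_ideal
                                 & (i == 0%N) ==> (a == 0)]].

Lemma form_ideal_closed : [/\ 0 \in form_ideal,
  {in form_ideal &, forall u v, u + v \in form_ideal} &
  forall a, {in form_ideal, forall u, a * u \in form_ideal}].
Proof.
split.
- by apply/asboolP; exists (fun=> 0); rewrite big1 // => i _; rewrite mul0r.
- move=> u v /asboolP[c ->] /asboolP[e ->]; apply/asboolP.
  exists (fun i => c i + e i); rewrite -big_split /=.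
  by apply: eq_bigr => i _; rewrite mulrDl.
- move=> a u /asboolP[c ->]; apply/asboolP; exists (fun i => a * c i).
  by rewrite mulr_sumr; apply: eq_bigr => i _; rewrite mulrA.
Qed.

Lemma form_ideal_homog a : a \in form_ideal -> in_sum J_ a.
Proof.
have [I0 ID IM] := form_ideal_closed.
have J0 i : 0 \in J_ i by rewrite inE /= piece0 I0 eqxx implybT.
have JD i : {in J_ i &, forall x y, x + y \in J_ i}.
  move=> x y /and3P[xA xI x0] /and3P[yA yI y0]; rewrite inE /= pieceD // ID //=.
  apply/implyP => i0; rewrite i0 /= in x0 y0.
  by rewrite (eqP x0) (eqP y0) addr0.
move=> /asboolP[c ->]; apply: in_sum_sum => // k _.
have xI : (map val s)`_k \in form_ideal.
  apply/asboolP; exists (fun i : nat => (i == k :> nat)%:R).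
  rewrite (bigD1 k) //= eqxx mul1r big1 ?addr0 // => i ik.
  by rewrite (_ : (nat_of_ord i == k) = false) ?mul0r //; apply: negbTE.
have xA : (map val s)`_k \in piece A 1.
  have /mapP[x _ ->] : (map val s)`_k \in map val s by apply: mem_nth.
  exact: valP.
have [n [f [Af ->]]] := grading_span (pieceP A) (c k).
rewrite mulr_suml; apply: in_sum_sum => // i _.
apply: (@in_sum1 _ _ J0 (i + 1)); rewrite inE /= IM //.
by rewrite (grading_mul (pieceP A)) // addn1.
Qed.

Fact form_ideal_idealr : idealr_closed form_ideal.
Proof.
have [I0 ID IM] := form_ideal_closed.
split=> // [|a u v uI vI]; last by rewrite ID ?IM.
apply/negP => /form_ideal_homog[n [g [Jg]]] e1.
have Ag i : g i \in piece A i by have /and3P[] := Jg i.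
pose f i : A := if i == 0%N then 1 else 0.
have Af i : f i \in piece A i.
  by rewrite /f; case: eqP => [->|_]; rewrite ?piece0 ?(grading_one (pieceP A)).
have := @piece_uniq K A 1 n f g Af Ag.
rewrite big_ord1 -e1 => /(_ erefl 0%N) /=.
have /and3P[_ _ /eqP->] := Jg 0%N.
by rewrite /f /= if_same => /eqP; rewrite oner_eq0.
Qed.

HB.instance Definition _ := isIdealr.Build A form_ideal form_ideal_idealr.

Definition quot_alg : comAlgType K := alg_quot form_ideal.

Definition quot_piece i : {pred quot_alg} := fun x =>
  `[< exists2 a, a \in piece A i & x = qproj form_ideal a >].

Fact quot_grading : is_grading quot_piece.
Proof.
split.
- move=> i; split; first by apply/asboolP; exists 0; rewrite ?piece0 ?rmorph0.
  move=> k x y /asboolP[a Aa ->] /asboolP[b Ab ->]; apply/asboolP.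
  by exists (k *: a + b); rewrite ?pieceZD // rmorphD /= qprojZ.
- by apply/asboolP; exists 1; rewrite ?rmorph1 ?(grading_one (pieceP A)).
- move=> i j x y /asboolP[a Aa ->] /asboolP[b Ab ->]; apply/asboolP.
  by exists (a * b); rewrite ?rmorphM ?(grading_mul (pieceP A)).
- move=> x; have [a ->] := qproj_surj x.
  have [n [f [Af ->]]] := grading_span (pieceP A) a.
  exists n, (fun i => qproj form_ideal (f i)); rewrite rmorph_sum; split=> // i.
  by apply/asboolP; exists (f i).
- move=> n F AF F0 i lt_in.
  have /choice[f Hf] : forall i, exists a, a \in piece A i /\ F i = qproj form_ideal a.
    by move=> j; have /asboolP[a] := AF j; exists a.
  have Af j : f j \in piece A j by case: (Hf j).
  have : \sum_(j < n) f j \in form_ideal.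
    rewrite -qproj_eq0 rmorph_sum -[X in _ == X]F0; apply/eqP.
    by apply: eq_bigr => j _; case: (Hf j).
  move=> /form_ideal_homog[m [g [Jg fg]]].
  have Ag j : g j \in piece A j by have /and3P[] := Jg j.
  have := piece_uniq Af Ag fg i; rewrite lt_in => fi.
  rewrite (proj2 (Hf i)); apply/eqP; rewrite qproj_eq0 fi.
  by case: ifP => _; [have /and3P[] := Jg i|case: form_ideal_closed].
Qed.

(* A / (s), with the induced grading *)
Definition graded_quot : gradedAlg K := GradedAlg quot_grading.

End GradedQuotient.

Section Veronese.
Variables (K : fieldType) (A : gradedAlg K) (r : nat).

Definition veronese_pred : {pred A} := fun a =>
  `[< in_sum (fun i => piece A (i * r)) a >].

Fact veronese_closed : GRing.subalg_closed veronese_pred.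
Proof.
have P0 i : 0 \in piece A (i * r) by apply: piece0.
have PD i : {in piece A (i * r) &, forall x y, x + y \in piece A (i * r)}.
  exact: pieceD.
split.
- apply/asboolP; apply: (@in_sum1 _ _ P0 0%N).
  by rewrite mul0n (grading_one (pieceP A)).
- move=> k u v /asboolP[n [f [Af ->]]] /asboolP vS; apply/asboolP.
  apply: (in_sumD P0 PD) => //; rewrite scaler_sumr.
  apply: (in_sum_sum P0 PD) => i _; apply: (@in_sum1 _ _ P0 i).
  exact: pieceZ.
- move=> u v /asboolP[n [f [Af ->]]] /asboolP[m [g [Ag ->]]]; apply/asboolP.
  rewrite mulr_suml; apply: (in_sum_sum P0 PD) => i _.
  rewrite mulr_sumr; apply: (in_sum_sum P0 PD) => j _.
  apply: (@in_sum1 _ _ P0 (i + j)%N); rewrite mulnDl.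
  exact: (grading_mul (pieceP A)).
Qed.

HB.instance Definition _ := GRing.isSubalgClosed.Build K A veronese_pred veronese_closed.

Definition veronese_alg : Type := {a : A | a \in veronese_pred}.
HB.instance Definition _ := SubChoice.on veronese_alg.
HB.instance Definition _ := [SubChoice_isSubAlgebra of veronese_alg by <:].
HB.instance Definition _ := [SubNzRing_isSubComNzRing of veronese_alg by <:].

Definition veronese_piece i : {pred veronese_alg} := fun a =>
  val a \in piece A (i * r).

Lemma sum_multiples (f : nat -> A) n : (0 < r)%N ->
  \sum_(j < n * r) (if (r %| j)%N then f (j %/ r)%N else 0) = \sum_(i < n) f i.
Proof.
move=> r_gt0; elim: n => [|n IHn]; first by rewrite mul0n !big_ord0.
rewrite big_ord_recr /= -IHn mulSn (addnC r) big_split_ord /=; congr (_ + _).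
rewrite (bigD1 (Ordinal r_gt0)) //= addn0 dvdn_mull // mulnK // big1 ?addr0 //.
move=> [j lt_jr]; rewrite -val_eqE /= => j0.
by rewrite dvdn_addr ?dvdn_mull // gtnNdvd // lt0n.
Qed.

Fact veronese_grading : (0 < r)%N -> is_grading veronese_piece.
Proof.
move=> r_gt0; split.
- move=> i; split=> [|k u v]; rewrite !unfold_in; first exact: piece0.
  by rewrite linearP; apply: pieceZD.
- by rewrite unfold_in rmorph1 mul0n (grading_one (pieceP A)).
- move=> i j u v; rewrite !unfold_in rmorphM mulnDl.
  exact: (grading_mul (pieceP A)).
- move=> u; have /asboolP[n [f [Af uE]]] := valP u.
  have Sf i : f i \in veronese_pred.
    by apply/asboolP; apply: (@in_sum1 _ _ _ i) => // j; apply: piece0.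
  exists n, (fun i => Sub (f i) (Sf i)); split=> [i|].
    by rewrite unfold_in SubK.
  by apply: val_inj; rewrite uE rmorph_sum; apply: eq_bigr.
- move=> n f Af f0 i lt_in; apply: val_inj; rewrite rmorph0.
  pose g j : A := if (r %| j)%N then val (f (j %/ r)%N) else 0.
  have Ag j : g j \in piece A j.
    rewrite /g; case: ifP => [rj|_]; last exact: piece0.
    by have := Af (j %/ r)%N; rewrite unfold_in divnK.
  have g0 : \sum_(j < n * r) g j = 0.
    rewrite (sum_multiples (fun i => val (f i))) //.
    by have := congr1 val f0; rewrite rmorph0 rmorph_sum.
  have := grading_free (pieceP A) Ag g0 (i := (i * r)%N).
  by rewrite ltn_pmul2r // /g dvdn_mull // mulnK //; apply.
Qed.

Definition veronese (r_gt0 : (0 < r)%N) : gradedAlg K :=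
  GradedAlg (veronese_grading r_gt0).

Fact power_in_veronese (x : linear_form A) : val x ^+ r \in veronese_pred.
Proof.
apply/asboolP; apply: (@in_sum1 _ _ _ 1%N) => [i|]; first exact: piece0.
exact: pieceX (valP x).
Qed.

Fact power_veronese1 (r_gt0 : (0 < r)%N) (x : linear_form A) :
  (Sub (val x ^+ r) (power_in_veronese x) : veronese r_gt0)
    \in piece (veronese r_gt0) 1.
Proof. by rewrite unfold_in SubK; apply: pieceX (valP x). Qed.

(* x ^ r, seen as a degree one element of the Veronese subalgebra *)
Definition veronese_power (r_gt0 : (0 < r)%N) (x : linear_form A) :
  linear_form (veronese r_gt0) :=
  exist (fun y : veronese r_gt0 => y \in piece (veronese r_gt0) 1)
    _ (power_veronese1 r_gt0 x).

End Veronese.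

Section Main.
Variables (K : fieldType) (A : gradedAlg K).

Definition is_lsop (d : nat) (Theta : d.-tuple (linear_form A)) : Prop :=
  krull_dim A d /\ exists n, @has_dim K (graded_quot Theta) predT n.

(* A^<r> / (theta_1^r, ..., theta_d^r) *)
Definition veronese_quot (d : nat) (Theta : d.-tuple (linear_form A))
    (r : nat) (r_gt0 : (0 < r)%N) : gradedAlg K :=
  graded_quot [seq veronese_power r_gt0 x | x <- Theta].

End Main.

Section Lefschetz.
Variables (K : fieldType) (B : gradedAlg K).

Definition lefschetz (k : nat) : Prop :=
  exists2 w : B, w \in piece B 1 &
    (0 < k)%N -> forall i, (i <= (k - 1) %/ 2)%N ->
      {in piece B i &, injective (fun p => w ^+ (k - 2 * i) * p)}.

Definition top_degree (sigma : nat) : Prop :=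
  (exists2 b, b \in piece B sigma & b != 0) /\
  forall i, (sigma < i)%N -> forall b, b \in piece B i -> b = 0.

(* if sigma = 0 then the truncated sigma - 1 is 0 instead of -1; both the 0- and
   the (-1)-Lefschetz properties are vacuous *)
Definition almost_strong_lefschetz : Prop :=
  exists2 sigma, top_degree sigma & lefschetz (sigma - 1).

End Lefschetz.

(* Main.v *)
From HB Require Import structures.
Require Import Defs.
From mathcomp Require Import all_boot all_order all_algebra.
From mathcomp Require Import boolp ring zify.

(** Write I for the ideal of the theta_i, J for the ideal of their powers
theta_i ^ r, and w for the sum of the theta_i. A class of degree i in
the Veronese quotient is represented by an element of A of degree i r, and it
is zero exactly when this representative lies in J (homogeneous coefficients
can be taken in the Veronese subalgebra). With the linear form w ^ r, both
claims follow from one statement about A: if p is homogeneous of degree n,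
w ^ m p lies in J and 2 n + m <= d (r - 1), then p lies in J. It says that
A / J inherits the strong Lefschetz property of K[x_1..x_d]/(x_i ^ r).

_Regularity_. Cohen-Macaulayness gives some homogeneous regular sequence t of
length d. As A / I is finite-dimensional, the elements of t are nilpotent
modulo I, hence modulo any d powers of the theta_i. The Koszul complex turns
this into regularity ([koszul_parameters_exact]): if s has no more elements
than the regular sequence t, and the elements of t are nilpotent modulo (s),
the Koszul complex of s is acyclic. Indeed the Koszul complex of t and s
together has no homology above degree [size s], since t is regular, whereas
adjoining to s an element nilpotent modulo (s) moves the top degree of the
homology up by exactly one. Reading off the degree 1 part, each theta_i is a
nonzerodivisor modulo arbitrary powers of the others ([theta_regular]).

_Leading forms_. It follows that (J : (theta_1 ... theta_d) ^ (r - 1)) = I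
([power_ideal_colon]), hence that a combination of monomials of the same
degree with exponents less than r lies in J only if its coefficients lie in I
([leading_coefficients]): multiplying by a complementary monomial isolates
each coefficient. So the graded ring of A / J for the I-adic filtration is
(A / I)[x_1..x_d]/(x_i ^ r), and w acts on it as the sum of the variables.

_sl2_. On these truncated polynomials, multiplication by the sum of the
variables is one of the operators of a representation of sl2, for which a form of
degree n has weight 2 n - d (r - 1) up to sign. In characteristic 0 its m-th
power is therefore injective in degree n when 2 n + m <= d (r - 1)
([raise_injective]). Climbing the I-adic filtration, p lies in
I ^ n.+1 + J ([lefschetz_adic]), hence in J as it has degree n.

_Almost strong Lefschetz_. Since the theta_i form a regular sequence, the
h-polynomial is the Hilbert series of A / I ([prefix_codim]), so A_n lies in I
for n > r. Then A_n lies in J for n > r + d (r - 1), so the quotient vanishes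
in degrees greater than s + 1; the property proved for s holds as well for all
smaller integers, among which sigma - 1. *)

Set Implicit Arguments.
Unset Strict Implicit.
Unset Printing Implicit Defensive.

Import GRing.Theory.
Local Open Scope ring_scope.

(** * Finitely generated ideals *)

Section Ideals.
Variable R : comNzRingType.
Implicit Types (s t : seq R) (a b x y : R).

Lemma ideal_gen_closed s : [/\ 0 \in ideal_gen s,
  {in ideal_gen s &, forall a b, a + b \in ideal_gen s} &
  forall c, {in ideal_gen s, forall a, c * a \in ideal_gen s}].
Proof.
split; first by apply/asboolP; exists (fun=> 0); rewrite big1 // => i _; rewrite mul0r.
- move=> a b /asboolP[c ->] /asboolP[e ->]; apply/asboolP.
  exists (fun i => c i + e i); rewrite -big_split /=.
  by apply: eq_bigr => i _; rewrite mulrDl.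
- move=> x a /asboolP[c ->]; apply/asboolP; exists (fun i => x * c i).
  by rewrite mulr_sumr; apply: eq_bigr => i _; rewrite mulrA.
Qed.

Lemma ideal0 s : 0 \in ideal_gen s.
Proof. by case: (ideal_gen_closed s). Qed.

Lemma idealD s : {in ideal_gen s &, forall a b, a + b \in ideal_gen s}.
Proof. by case: (ideal_gen_closed s). Qed.

Lemma ideal_mull s c a : a \in ideal_gen s -> c * a \in ideal_gen s.
Proof. by case: (ideal_gen_closed s) => _ _; apply. Qed.

Lemma ideal_mulr s c a : a \in ideal_gen s -> a * c \in ideal_gen s.
Proof. by rewrite mulrC; apply: ideal_mull. Qed.

Lemma idealB s : {in ideal_gen s &, forall a b, a - b \in ideal_gen s}.
Proof. by move=> a b sa sb; rewrite -mulN1r idealD // ideal_mull. Qed.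

Lemma idealDr s a b : b \in ideal_gen s -> (a + b \in ideal_gen s) = (a \in ideal_gen s).
Proof.
move=> sb; apply/idP/idP => sa; last exact: idealD.
by rewrite -[a](addrK b); apply: (idealB sa sb).
Qed.

Lemma ideal_sum s T (r : seq T) (P : pred T) (F : T -> R) :
  (forall i, P i -> F i \in ideal_gen s) -> \sum_(i <- r | P i) F i \in ideal_gen s.
Proof. by move=> PF; apply: (big_ind [in ideal_gen s]) => //; [apply: ideal0|apply: idealD]. Qed.

Lemma mem_ideal s x : x \in s -> x \in ideal_gen s.
Proof.
move=> sx; apply/asboolP; exists (fun i => (i == index x s)%:R).
have ltx : (index x s < size s)%N by rewrite index_mem.
rewrite (bigD1 (Ordinal ltx)) //= eqxx mul1r nth_index // big1 ?addr0 // => i ix.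
by rewrite (_ : (i == index x s :> nat) = false) ?mul0r //; apply: negbTE.
Qed.

Lemma ideal_sub s t : {in s, forall x, x \in ideal_gen t} ->
  {subset ideal_gen s <= ideal_gen t}.
Proof.
move=> st a /asboolP[c ->]; apply: ideal_sum => i _; apply: ideal_mull.
by apply: st; apply: mem_nth.
Qed.

Lemma ideal_subset s t : {subset s <= t} -> {subset ideal_gen s <= ideal_gen t}.
Proof. by move=> st; apply: ideal_sub => x sx; apply/mem_ideal/st. Qed.

Lemma ideal_consP x s a :
  reflect (exists c, exists2 b, b \in ideal_gen s & a = c * x + b)
          (a \in ideal_gen (x :: s)).
Proof.
apply: (iffP idP) => [/asboolP[c ->]|[c [b sb ->]]].
  rewrite big_ord_recl /=; exists (c 0%N), (\sum_(i < size s) c i.+1 * s`_i) => //.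
  by apply/asboolP; exists (fun i => c i.+1).
apply: idealD; first by apply/ideal_mull/mem_ideal/mem_head.
by apply: (ideal_subset _ sb) => y ys; rewrite in_cons ys orbT.
Qed.

Lemma ideal_mapP (T : eqType) (s : seq T) (g : T -> R) a : uniq s ->
  reflect (exists c : T -> R, a = \sum_(i <- s) c i * g i)
          (a \in ideal_gen [seq g i | i <- s]).
Proof.
move=> us; apply: (iffP idP) => [|[c ->]]; last first.
  rewrite big_seq; apply: ideal_sum => i si.
  by apply/ideal_mull/mem_ideal/map_f.
elim: s us a => [|x s IHs] /= us a.
  by move=> /asboolP[c ->]; exists (fun=> 0); rewrite big_ord0 big_nil.
move=> /ideal_consP[e [b]]; case/andP: us => xs us /(IHs us)[c ->] ->.
exists (fun i => if i == x then e else c i); rewrite big_cons eqxx; congr (_ + _).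
apply: eq_big_seq => i si; case: eqP => // ix.
by rewrite -ix si in xs.
Qed.

Lemma ideal_enumP (T : finType) (P : pred T) (g : T -> R) a :
  reflect (exists c : T -> R, a = \sum_(i | P i) c i * g i)
          (a \in ideal_gen [seq g i | i <- enum P]).
Proof.
apply: (iffP (ideal_mapP _ _ (enum_uniq _))) => -[c ->]; exists c;
  by rewrite big_enum.
Qed.

Lemma ideal_family (T : finType) (P : pred T) (g : T -> R) i : P i ->
  g i \in ideal_gen [seq g i | i <- enum P].
Proof. by move=> Pi; apply/mem_ideal/map_f; rewrite mem_enum. Qed.

(** The elements nilpotent modulo [t] form an ideal, by the binomial formula. *)
Lemma ideal_radical s t x : {in s, forall y, exists n, y ^+ n \in ideal_gen t} ->
  x \in ideal_gen s -> exists n, x ^+ n \in ideal_gen t.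
Proof.
move=> st /asboolP[c ->].
apply: (big_ind (fun x => exists n, x ^+ n \in ideal_gen t)).
- by exists 1%N; rewrite expr1 ideal0.
- move=> a b [n an] [m bm]; exists (n + m)%N; rewrite exprDn.
  apply: ideal_sum => i _; rewrite -mulr_natr; apply: ideal_mulr.
  have [le_mi|/ltnW le_im] := leqP m i.
    by rewrite -(subnK le_mi) exprD mulrA ideal_mull.
  by rewrite -addnBA // exprD -mulrA ideal_mulr.
- move=> i _; have [n yn] := st _ (mem_nth 0 (ltn_ord i)).
  by exists n; rewrite exprMn ideal_mull.
Qed.

End Ideals.

(** * Koszul complexes *)

Section LinearMaps.
Variables (R : pzRingType) (U V : lmodType R) (f : U -> V).
Hypothesis fP : linear f.

Lemma lin0 : f 0 = 0.
Proof. by apply: (addrI (f 0)); have := fP 1 0 0; rewrite /= !scale1r !addr0. Qed.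

Lemma linZ k u : f (k *: u) = k *: f u.
Proof. by have := fP k u 0; rewrite lin0 !addr0. Qed.

Lemma linD u v : f (u + v) = f u + f v.
Proof. by have := fP 1 u v; rewrite !scale1r. Qed.

Lemma linN u : f (- u) = - f u.
Proof. by rewrite -scaleN1r linZ scaleN1r. Qed.

End LinearMaps.

Section Koszul.
Variable R : comNzRingType.

(** A chain complex, given as its total module with the submodules
   [chain i] of homogeneous elements: homological degrees then never occur
   in types. *)
Record complex := Complex {
  total :> lmodType R;
  bd : total -> total;
  chain : nat -> total -> Prop;
  bdP : linear bd;
  bd_bd : forall u, bd (bd u) = 0;
  chain0 : forall i, chain i 0;
  chainP : forall i k u v, chain i u -> chain i v -> chain i (k *: u + v);
  bd_chain : forall i u, chain i.+1 u -> chain i (bd u);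
  bd_chain0 : forall u, chain 0 u -> bd u = 0 }.

Section Theory.
Variable C : complex.
Implicit Types u v : C.

Lemma bd0 : bd (0 : C) = 0. Proof. exact: lin0 (@bdP C). Qed.
Lemma bdZ k u : bd (k *: u) = k *: bd u. Proof. exact: (linZ (@bdP C)). Qed.
Lemma bdD u v : bd (u + v) = bd u + bd v. Proof. exact: (linD (@bdP C)). Qed.
Lemma bdN u : bd (- u) = - bd u. Proof. exact: (linN (@bdP C)). Qed.

Lemma chainD i u v : chain i u -> chain i v -> chain i (u + v).
Proof. by move=> cu cv; rewrite -[u]scale1r; apply: chainP. Qed.

Lemma chainZ i k u : chain i u -> chain i (k *: u).
Proof. by move=> cu; rewrite -[_ *: _]addr0; apply: chainP => //; apply: chain0. Qed.

Lemma chainN i u : chain i u -> chain i (- u).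
Proof. by rewrite -scaleN1r; apply: chainZ. Qed.

Definition exact_at i := forall u, chain i u -> bd u = 0 ->
  exists2 e : C, chain i.+1 e & bd e = u.

(** The multiplication by [z] is injective on the homology in degree [i]. *)
Definition homology_regular (z : R) i := forall u (e : C),
  chain i u -> bd u = 0 -> chain i.+1 e -> z *: u = bd e ->
  exists2 e' : C, chain i.+1 e' & bd e' = u.

Definition null_homotopic (z : R) := exists h : C -> C,
  [/\ linear h,
      forall i u, chain i u -> chain i.+1 (h u) &
      forall u, bd (h u) + h (bd u) = z *: u].

(** The elements of degree [i - 1], where degree [-1] is zero. *)
Definition pchain i : C -> Prop := if i is j.+1 then chain j else eq^~ 0.

Lemma pchainP i k u v : pchain i u -> pchain i v -> pchain i (k *: u + v).
Proof. by case: i => [/= -> ->|i]; [rewrite scaler0 addr0|apply: chainP]. Qed.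

End Theory.

Section Cone.
Variables (z : R) (C : complex).

Definition cone_bd (u : C * C) : C * C := (bd u.1 + z *: u.2, - bd u.2).
Definition cone_chain i (u : C * C) := chain i u.1 /\ pchain i u.2.

Fact cone_bdP : linear cone_bd.
Proof.
move=> k u v.
rewrite /cone_bd /= !bdP; congr (_, _) => /=; last by rewrite opprD scalerN.
by rewrite !scalerDr !scalerA addrACA (mulrC k).
Qed.

Fact cone_bd_bd u : cone_bd (cone_bd u) = 0.
Proof.
by rewrite /cone_bd /= !(bdD, bdN, bdZ, bd_bd) add0r scalerN subrr opprK.
Qed.

Fact cone_chain0 i : cone_chain i 0.
Proof. by split; [exact: chain0|case: i => //= i; exact: chain0]. Qed.

Fact cone_chainP i k u v :
  cone_chain i u -> cone_chain i v -> cone_chain i (k *: u + v).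
Proof. by move=> [u1 u2] [v1 v2]; split; [apply: chainP|apply: pchainP]. Qed.

Fact cone_bd_chain i u : cone_chain i.+1 u -> cone_chain i (cone_bd u).
Proof.
move=> [/= u1 u2]; split => /=; first by apply: chainD; [apply: bd_chain|apply: chainZ].
case: i u1 u2 => [|i] u1 u2 /=; first by rewrite bd_chain0 ?oppr0.
by apply/chainN/bd_chain.
Qed.

Fact cone_bd_chain0 u : cone_chain 0 u -> cone_bd u = 0.
Proof. by case: u => u v [/= u1 ->]; rewrite /cone_bd /= bd_chain0 // bd0 scaler0 addr0 oppr0. Qed.

(** The mapping cone of the multiplication by [z] on [C]. *)
Definition cone := @Complex (C * C)%type cone_bd cone_chain cone_bdP cone_bd_bd
  cone_chain0 cone_chainP cone_bd_chain cone_bd_chain0.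

(** The two halves of the long exact sequence relating the homologies of [C]
   and of the cone, the connecting map being the multiplication by [z]. *)
Lemma cone_exact i : exact_at C i.+1 -> homology_regular C z i -> exact_at cone i.+1.
Proof.
move=> exC reg [a b] [/= ca cb] [/eqP]; rewrite addr_eq0 => /eqP ab /eqP.
rewrite oppr_eq0 => /eqP b0.
have [||e ce eb] := reg b (- a) cb b0; first exact: chainN.
  by rewrite bdN ab opprK.
have [||f cf fa] := exC (a + z *: e).
- by apply: chainD => //; apply: chainZ.
- by rewrite bdD bdZ eb ab addNr.
exists (f, - e); first by split=> //=; apply: chainN.
by rewrite /= /cone_bd /= fa bdN eb opprK scalerN addrK.
Qed.

Lemma cone_exact_regular i : exact_at cone i.+1 -> homology_regular C z i.
Proof.
move=> exC u e cu u0 ce zu.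
have [||[f g] [/= cf cg] [_ gu]] := exC (- e, u).
- by split=> //=; apply: chainN.
- by rewrite /= /cone_bd /= bdN zu addNr u0 oppr0.
by exists (- g); [apply: chainN|rewrite bdN].
Qed.

Lemma null_homotopic_cone : null_homotopic cone z.
Proof.
exists (fun u => (0, u.1)); split=> [k u v|i u [u1 u2]|u] /=.
- by congr (_, _) => /=; rewrite scaler0 addr0.
- by split => //=; apply: chain0.
rewrite /cone_bd /= bd0 add0r; congr (_, _); first by rewrite addr0.
by rewrite /= addKr.
Qed.

Lemma null_homotopic_lift u : null_homotopic C u -> null_homotopic cone u.
Proof.
case=> h [hP hc hu].
exists (fun u => (h u.1, - h u.2)); split=> [k a b|i [a b] [/= ca cb]|[a b]] /=.
- by congr (_, _); rewrite /= hP // opprD scalerN.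
- split=> /=; first exact: hc.
  case: i {ca} cb => [|i] /= => [->|cb]; last exact/chainN/hc.
  by rewrite (lin0 hP) oppr0; apply: chain0.
rewrite /cone_bd /= (linD hP) (linZ hP) bdN opprK; congr (_, _) => /=.
  by rewrite scalerN addrACA hu addNr addr0.
by rewrite (linN hP) opprK hu.
Qed.

(** If multiplication by [z] is both injective and nilpotent on a homology
   module, that module is zero; and exactness of the cone provides the
   injectivity. *)
Lemma exact_of_cone i n : exact_at cone i.+1 -> null_homotopic C (z ^+ n) ->
  exact_at C i.
Proof.
move=> /cone_exact_regular reg [h [hP hc hz]] u cu u0.
have: exists2 e : C, chain i.+1 e & bd e = z ^+ n *: u.
  by exists (h u); [apply: hc|have := hz u; rewrite u0 (lin0 hP) addr0].
elim: n {h hP hc hz} => [|n IHn] [e ce eE].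
  by exists e => //; rewrite eE scale1r.
apply: IHn; apply: (reg (z ^+ n *: u) e) => //.
- exact: chainZ.
- by rewrite bdZ u0 scaler0.
- by rewrite eE exprS scalerA.
Qed.

End Cone.

(** A one-sided inverse suffices to carry exactness from [C] to [C']. *)
Definition retract (C C' : complex) := exists f g,
  [/\ linear (f : C -> C'),
      linear (g : C' -> C),
      forall i u, chain i u -> chain i (f u),
      forall i u, chain i u -> chain i (g u) &
      [/\ forall u, bd (f u) = f (bd u), forall u, bd (g u) = g (bd u) &
          cancel g f]].

Lemma retract_refl C : retract C C.
Proof. by exists id, id; split. Qed.

Lemma retract_trans C1 C2 C3 : retract C1 C2 -> retract C2 C3 -> retract C1 C3.
Proof.
move=> [f [g [fP gP fc gc [fb gb gf]]]] [f' [g' [fP' gP' fc' gc' [fb' gb' gf']]]].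
exists (f' \o f), (g \o g'); split=> [k u v|k u v|i u cu|i u cu|] /=.
- by rewrite fP fP'.
- by rewrite gP' gP.
- by apply/fc'/fc.
- by apply/gc/gc'.
by split=> u /=; rewrite ?fb' ?fb ?gb ?gb' ?gf ?gf'.
Qed.

Lemma retract_exact C C' i : retract C C' -> exact_at C i -> exact_at C' i.
Proof.
move=> [f [g [fP gP fc gc [fb gb gf]]]] exC u cu u0.
have [||e ce eE] := exC (g u); first exact: gc.
  by rewrite gb u0 (lin0 gP).
by exists (f e); [apply: fc|rewrite fb eE gf].
Qed.

Lemma retract_cone z C C' : retract C C' -> retract (cone z C) (cone z C').
Proof.
move=> [f [g [fP gP fc gc [fb gb gf]]]].
exists (fun u => (f u.1, f u.2)), (fun u => (g u.1, g u.2)).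
split=> [k u v|k u v|i [a b] [/= ca cb]|i [a b] [/= ca cb]|] /=.
- by rewrite !fP.
- by rewrite !gP.
- by split=> /=; [apply: fc|case: i {ca} cb => [|i] /= => [->|]; [exact: lin0 fP|apply: fc]].
- by split=> /=; [apply: gc|case: i {ca} cb => [|i] /= => [->|]; [exact: lin0 gP|apply: gc]].
split=> -[a b]; rewrite /cone_bd /=.
- by rewrite !fb (linD fP) (linZ fP) (linN fP).
- by rewrite !gb (linD gP) (linZ gP) (linN gP).
- by rewrite !gf.
Qed.

(** The sign makes the exchange of the two middle copies of [C] commute with
   the differentials. *)
Lemma retract_swap z w C : retract (cone z (cone w C)) (cone w (cone z C)).
Proof.
pose sw (u : (C * C) * (C * C)) := ((u.1.1, u.2.1), (u.1.2, - u.2.2)).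
have swP : linear sw.
  by move=> k u v; rewrite /sw /= opprD -scalerN.
have swc (z1 z2 : R) i (u : cone z1 (cone z2 C)) :
    chain i u -> @chain (cone z2 (cone z1 C)) i (sw u).
  case: u => -[a b] [c e]; case: i => [|[|i]] [[/= ca cb]] /=.
  - by move=> [-> ->]; rewrite /sw /= cb oppr0.
  - by move=> [/= cc ->]; rewrite /sw /= oppr0.
  - by move=> [/= cc ce]; split; split=> //=; apply: chainN.
exists sw, sw; split; [exact: swP|exact: swP|exact: swc|exact: swc|split].
- move=> [[a b] [c e]]; rewrite /= /cone_bd /sw /=; congr (_, _) => /=; congr (_, _) => /=.
  + by rewrite -!addrA [z *: c + _]addrC.
  + by rewrite opprD scalerN.
  + by rewrite scalerN opprD opprK.
  + by rewrite bdN opprK.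
- move=> [[a b] [c e]]; rewrite /= /cone_bd /sw /=; congr (_, _) => /=; congr (_, _) => /=.
  + by rewrite -!addrA [w *: c + _]addrC.
  + by rewrite opprD scalerN.
  + by rewrite scalerN opprD opprK.
  + by rewrite bdN opprK.
by move=> [[a b] [c e]]; rewrite /sw /= opprK.
Qed.

End Koszul.

Section KoszulComplex.
Variable R : comNzRingType.
Implicit Types (s t : seq R) (a b x y z : R).

(** The ring itself, concentrated in degree 0. *)
Definition ring_complex : complex R.
Proof.
refine (@Complex R R^o (fun=> 0) (fun i (u : R^o) => if i is 0%N then True else u = 0)
  _ _ _ _ _ _) => //.
- by move=> k u v; rewrite scaler0 addr0.
- by case.
- by case=> [|i] k u v //= -> ->; rewrite scaler0 addr0.
- by case.
Defined.

Definition koszul s : complex R := foldr (@cone R) ring_complex s.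

Fixpoint koszul_unit s a : koszul s :=
  if s is z :: s' return koszul s then (koszul_unit s' a, 0) else a.

Lemma koszul_unit_linear s : linear (koszul_unit s : R^o -> koszul s).
Proof.
elim: s => //= z s IHs k a b; congr (_, _) => /=; first exact: IHs.
by rewrite scaler0 addr0.
Qed.

Lemma koszul_chain0P s (u : koszul s) :
  chain 0 u <-> exists a, u = koszul_unit s a.
Proof.
elim: s u => [|z s IHs] /= u; first by split=> // _; exists u.
split=> [[/IHs[a ua] u0]|[a ->]].
  by exists a; case: u ua u0 => u v /= -> ->.
by split=> //; apply/IHs; exists a.
Qed.

(** The homology in degree 0 is the quotient by the ideal. *)
Lemma koszul_boundary0P s a :
  (exists2 e : koszul s, chain 1 e & bd e = koszul_unit s a) <-> a \in ideal_gen s.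
Proof.
elim: s a => [|z s IHs] a /=.
  split=> [[e _ /= <-]|]; first exact: ideal0.
  by move=> /asboolP[c ->]; exists 0; rewrite //= big_ord0.
have uP := koszul_unit_linear s.
split=> [[[e f] [/= e1 /koszul_chain0P[b ->]] [ef _]]|/ideal_consP[c [b sb ->]]].
  apply/ideal_consP; exists b, (a - b * z); last by rewrite addrC subrK.
  apply/IHs; exists e => //; apply: (addIr (z *: koszul_unit s b)).
  by rewrite ef -(linZ uP) -(linD uP) /= mulrC subrK.
have [e e1 eb] := (IHs b).2 sb.
exists (e, koszul_unit s c); first by split=> //=; apply/koszul_chain0P; exists c.
rewrite /= /cone_bd /= eb (bd_chain0 (u := koszul_unit s c)) ?oppr0; last first.
  by apply/koszul_chain0P; exists c.
by rewrite -(linZ uP) -(linD uP) /= addrC mulrC.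
Qed.

Lemma homology_regular0P s z : homology_regular (koszul s) z 0 <->
  (forall a, z * a \in ideal_gen s -> a \in ideal_gen s).
Proof.
have uP := koszul_unit_linear s.
split=> [reg a /koszul_boundary0P[e e1 ea]|reg u e /koszul_chain0P[a ->] _ e1 ea].
  apply/koszul_boundary0P; apply: (reg _ e) => //.
  - by apply/koszul_chain0P; exists a.
  - by apply: bd_chain0; apply/koszul_chain0P; exists a.
  - by rewrite ea -(linZ uP).
apply/koszul_boundary0P/reg/koszul_boundary0P; exists e => //.
by rewrite -ea -(linZ uP).
Qed.

Lemma koszul_regular s : regular_seq s ->
  forall i, exact_at (koszul (rev s)) i.+1.
Proof.
move=> [_ reg].
suff H n : (n <= size s)%N -> forall i, exact_at (koszul (rev (take n s))) i.+1.
  by move=> i; have := H (size s) (leqnn _) i; rewrite take_size.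
elim: n => [_ i|n IHn lt_n i].
  by rewrite take0 => u /= u0 _; exists 0; rewrite ?u0.
rewrite (take_nth 0 lt_n) rev_rcons /=; apply: cone_exact; first exact: IHn (ltnW _) _.
case: i => [|i]; last first.
  move=> u e cu u0 _ _; exact: IHn (ltnW lt_n) i u cu u0.
have eqI t : ideal_gen (rev t) =i ideal_gen t.
  by move=> a; apply/idP/idP; apply: ideal_subset => y; rewrite mem_rev.
by apply/homology_regular0P => a; rewrite !eqI; apply: reg.
Qed.

Lemma koszul_exact_cat s t : (forall i, exact_at (koszul t) i.+1) ->
  forall i, exact_at (koszul (s ++ t)) (size s + i).+1.
Proof.
move=> ext; elim: s => //= z s IHs i.
have step j : exact_at (koszul (s ++ t)) (size s + j).+1 by [].
rewrite addSn; apply: cone_exact; first by have := step i.+1; rewrite addnS.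
move=> u e cu u0 _ _; exact: step cu u0.
Qed.

Lemma koszul_rcons s z : retract (koszul (z :: s)) (koszul (rcons s z)).
Proof.
elim: s => [|w s IHs] /=; first exact: retract_refl.
by apply: retract_trans (retract_swap _ _ _) _; apply: retract_cone.
Qed.

Lemma koszul_catC s t : retract (koszul (s ++ t)) (koszul (t ++ s)).
Proof.
elim: s t => [|z s IHs] t; first by rewrite cats0; apply: retract_refl.
apply: retract_trans (koszul_rcons _ _) _.
by rewrite rcons_cat; have := IHs (rcons t z); rewrite cat_rcons.
Qed.

(** The null-homotopic multiplications form an ideal, containing each
   generator by the cone construction. *)
Lemma null_homotopic_koszul s t z : z \in ideal_gen t ->
  null_homotopic (koszul (s ++ t)) z.
Proof.
move=> tz; elim: s => [|y s IHs] /=; last exact: null_homotopic_lift.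
elim: t z tz => [|y t IHt] z /=.
  move=> /asboolP[c ->]; rewrite big_ord0; exists (fun=> 0); split=> [k u v|[]|u] //=.
  - by rewrite scaler0 addr0.
  - by rewrite scale0r addr0.
move=> /ideal_consP[c [b tb ->]].
have [h [hP hc hy]] := null_homotopic_cone y (koszul t).
have [k [kP kc kb]] := null_homotopic_lift y (IHt b tb).
exists (fun u => c *: h u + k u); split=> [a u v|i u cu|u].
- rewrite hP kP; rewrite !scalerDr !scalerA (mulrC c) -!addrA; congr (_ + _).
  by rewrite addrCA.
- by apply: (@chainP _ (cone y (koszul t))); [apply: hc|apply: kc].
- rewrite (@bdP _ (cone y (koszul t))) addrACA -scalerDr hy kb scalerA.
  by rewrite scalerDl.
Qed.

(** Adjoining [s] to [t], whose Koszul complex is acyclic, creates homology up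
   to degree [size s] only. Adjoining [t] to [s] gives the same complex; but each
   element of [t] is nilpotent on the homology of the previous complex, so
   that each one moves the top degree of the homology up by one. *)
Theorem koszul_parameters_exact t s :
  regular_seq t -> (size s <= size t)%N ->
  {in t, forall y, exists n, y ^+ n \in ideal_gen s} ->
  forall i, exact_at (koszul s) i.+1.
Proof.
move=> /koszul_regular ext le_st nil i.
have: exact_at (koszul (rev t ++ s)) (size (rev t) + i.+1).
  apply: retract_exact (koszul_catC s (rev t)) _.
  have := @koszul_exact_cat s (rev t) ext (size t + i - size s)%N.
  by rewrite subnKC ?size_rev ?addnS // (leq_trans le_st) ?leq_addr.
have {nil}: {in rev t, forall y, exists n, y ^+ n \in ideal_gen s}.
  by move=> y; rewrite mem_rev; apply: nil.
elim: (rev t) => //= y t' IHt nil; rewrite addSn => ex.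
have [n yn] := nil _ (mem_head _ _).
apply: IHt => [z t'z|]; first by apply: nil; rewrite in_cons t'z orbT.
by apply: exact_of_cone ex (null_homotopic_koszul _ yn).
Qed.

(** Exactness in degree 1 of the cone of [z] on [koszul s] means that [z] acts
   injectively on the homology of [koszul s] in degree 0. *)
Corollary parameters_regular t s z : regular_seq t -> (size s < size t)%N ->
  {in t, forall y, exists n, y ^+ n \in ideal_gen (z :: s)} ->
  forall a, z * a \in ideal_gen s -> a \in ideal_gen s.
Proof.
move=> reg le_st nil; apply/homology_regular0P/cone_exact_regular.
exact: (koszul_parameters_exact (s := z :: s) reg le_st nil).
Qed.

End KoszulComplex.

(** * An sl2 argument *)

Section SL2.
Variables (K : fieldType) (V : lmodType K) (E F : V -> V).
Variables (wt : nat -> V -> Prop) (X : V -> Prop) (D : nat).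
Hypothesis charK0 : [pchar K] =i pred0.
Hypothesis E_linear : linear E.
Hypothesis wtE : forall j c, wt j c -> wt j.+1 (E c).
Hypothesis wtF : forall j c, wt j.+1 c -> wt j (F c).
Hypothesis wtF0 : forall c, wt 0 c -> F c = 0.
Hypothesis X0 : X 0.
Hypothesis XP : forall k u v, X u -> X v -> X (k *: u + v).
Hypothesis XE : forall c, X c -> X (E c).
Hypothesis XF : forall c, X c -> X (F c).
Hypothesis commFE : forall j c, wt j c ->
  F (E c) = E (F c) + (D%:R - j.*2%:R) *: c.

Lemma wt_iter j m c : wt j c -> wt (j + m) (iter m E c).
Proof. by move=> wc; elim: m => [|m IHm] /=; rewrite ?addn0 // addnS; apply: wtE. Qed.

Lemma commF_iterE j m c : wt j c -> F (iter m.+1 E c) =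
  iter m.+1 E (F c) + (m.+1%:R * (D%:R - j.*2%:R - m%:R)) *: iter m E c.
Proof.
move=> wc; elim: m => [|m IHm]; first by rewrite /= (commFE wc) subr0 mul1r.
rewrite {1}iterS (commFE (wt_iter m.+1 wc)) IHm (linD E_linear) (linZ E_linear).
rewrite -!iterS -addrA -scalerDl; congr (_ + _ *: _).
rewrite -!muln2 !natrM !natrD -!natr1.
move: (D%:R : K) (j%:R : K) (m%:R : K) => x y z; ring.
Qed.

Lemma iterE_step j m c : wt j c -> (j.*2 + m < D)%N ->
  X (iter m.+1 E c) -> X (iter m.+1 E (F c)) -> X (iter m E c).
Proof.
move=> wc lt_D XEc XEFc.
pose k : K := m.+1%:R * (D%:R - j.*2%:R - m%:R).
have k0 : k != 0.
  rewrite /k -addrA -opprD -natrD -natrB ?(ltnW lt_D) // -natrM (pcharf0P K).1 //.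
  by rewrite muln_eq0 subn_eq0 -ltnNge.
have := XP (- 1) XEFc (XF XEc); rewrite (commF_iterE m wc) scaleN1r addKr.
move=> /(XP k^-1)/(_ X0); rewrite addr0 scalerA mulVf // scale1r.
exact.
Qed.

(** A vector killed by [E ^ m] is killed by [E ^ m.+1 F], hence [F] kills it by
   induction on the weight; the commutation relation then reads
   [E ^ m.-1 c = 0] up to a nonzero scalar. All this takes place in the
   quotient by the subrepresentation [X]. *)
Lemma sl2_injective j m c : wt j c -> (j.*2 + m <= D)%N ->
  X (iter m E c) -> X c.
Proof.
have Xiter n u : X u -> X (iter n E u) by move=> Xu; elim: n => //= n; apply: XE.
elim: j m c => [|j IHj] m c wc.
  elim: m => // m IHm le_D XEc; apply: IHm; first by lia.
  by apply: (iterE_step wc) => //; rewrite (wtF0 wc); apply: Xiter.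
elim: m => // m IHm le_D XEc; apply: IHm; first by lia.
apply: (iterE_step wc) => //; first by lia.
apply/Xiter/(IHj m.+2 _ (wtF wc)); first by lia.
have := XE (XF XEc); rewrite (commF_iterE m wc) (linD E_linear) (linZ E_linear).
rewrite -!iterS => /(XP (- (m.+1%:R * (D%:R - j.+1.*2%:R - m%:R))) XEc).
by rewrite addrCA scaleNr addNr addr0.
Qed.

End SL2.

(** * The action of sl2 on truncated polynomials *)

Section Box.
Variables (d q : nat).
Local Notation box := {ffun 'I_d -> 'I_q.+1}.
Implicit Types (al be : box) (i j : 'I_d).

Definition total_degree al := (\sum_i al i)%N.
Definition up i al : box := [ffun k => if k == i then inord (al k).+1 else al k].
Definition down i al : box := [ffun k => if k == i then inord (al k).-1 else al k].

Lemma upE i al k : (al i < q)%N -> up i al k = ((k == i) + al k)%N :> nat.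
Proof. by move=> lt; rewrite ffunE; case: eqP => // ->; rewrite inordK. Qed.

(** The value of [inord] out of range is 0. *)
Lemma up_max i al : (al i < q)%N = false -> up i al i = 0 :> nat.
Proof. by move=> ge; rewrite ffunE eqxx val_insubd ltnS ge. Qed.

Lemma downE i al k : down i al k = (al k - (k == i))%N :> nat.
Proof.
rewrite ffunE; case: eqP => _; last by rewrite subn0.
by rewrite inordK ?subn1 // (leq_ltn_trans (leq_pred _)).
Qed.

Lemma upK i al : (al i < q)%N -> down i (up i al) = al.
Proof.
by move=> lt; apply/ffunP => k; apply/val_inj; rewrite /= downE upE // addKn.
Qed.

Lemma downK i al : (0 < al i)%N -> up i (down i al) = al.
Proof.
move=> gt0; have le := ltn_ord (al i); apply/ffunP => k; apply/val_inj.
rewrite /= upE downE ?eqxx /=; last by lia.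
by case: eqP => [->|]; lia.
Qed.

Lemma down_up i j al : i != j -> down j (up i al) = up i (down j al).
Proof.
move=> ij; apply/ffunP => k; rewrite !ffunE.
by case: eqP => // ->; rewrite eq_sym (negbTE ij).
Qed.

Lemma total_degree_up i al : (al i < q)%N -> total_degree (up i al) = (total_degree al).+1.
Proof.
move=> lt; rewrite /total_degree (eq_bigr (fun k => (k == i) + al k)%N) => [|k _]; last exact: upE.
by rewrite big_split /= (bigD1 i) //= eqxx big1 // => k /negbTE->.
Qed.

Lemma total_degree_down i al : (0 < al i)%N -> (total_degree (down i al)).+1 = total_degree al.
Proof.
move=> gt0; rewrite -(@total_degree_up i) ?downK // downE eqxx.
by have := ltn_ord (al i); lia.
Qed.

Section Operators.
Variables (K : fieldType) (V : lmodType K).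
Implicit Types (c : {ffun box -> V}).

(** On [V] tensored with the truncated polynomials K[x_1..x_d]/(x_i ^ q.+1),
   [raise] is the multiplication by the sum of the variables, and [lower] is
   the sum of the operators sending x_i ^ a to a (q.+1 - a) x_i ^ a.-1: together
   they make each K[x]/(x ^ q.+1) the irreducible representation of sl2 of
   highest weight [q]. *)
Definition raise c : {ffun box -> V} :=
  [ffun be : box => \sum_i (if (0 < be i)%N then c (down i be) else 0)].
Definition lower c : {ffun box -> V} :=
  [ffun al : box => \sum_i ((al i).+1 * (q - al i))%:R *: c (up i al)].
Definition homogeneous n c := forall al, total_degree al != n -> c al = 0.

Lemma raise_linear : linear raise.
Proof.
move=> k c e; apply/ffunP => be; rewrite !ffunE scaler_sumr -big_split /=.
apply: eq_bigr => i _; rewrite !ffunE; case: ifP => // _.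
by rewrite scaler0 addr0.
Qed.

Lemma homogeneous_raise n c : homogeneous n c -> homogeneous n.+1 (raise c).
Proof.
move=> hc be be_n; rewrite ffunE big1 // => i _; case: ifP => // gt0.
by rewrite hc //; move: be_n; rewrite -(total_degree_down gt0) eqSS.
Qed.

Lemma lower_term n c al i : homogeneous n c -> (total_degree al).+1 != n ->
  ((al i).+1 * (q - al i))%:R *: c (up i al) = 0.
Proof.
move=> hc al_n; have [lt|ge] := ltnP (al i) q.
  by rewrite hc ?scaler0 // total_degree_up.
by rewrite (eqP ge) muln0 scale0r.
Qed.

Lemma homogeneous_lower n c : homogeneous n.+1 c -> homogeneous n (lower c).
Proof.
by move=> hc al al_n; rewrite ffunE big1 // => i _; apply: lower_term hc _; rewrite eqSS.
Qed.

Lemma lower0 c : homogeneous 0 c -> lower c = 0.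
Proof.
by move=> hc; apply/ffunP => al; rewrite !ffunE big1 // => i _; apply: lower_term hc _.
Qed.

(** Operators attached to different variables commute; for a single variable, the
   commutator multiplies x_i ^ a by (a + 1) (q - a) - a (q + 1 - a) = q - 2 a. *)
Lemma lower_raise n c : homogeneous n c ->
  lower (raise c) = raise (lower c) + ((d * q)%:R - n.*2%:R) *: c.
Proof.
move=> hc; apply/ffunP => al; rewrite !ffunE.
have -> : ((d * q)%:R - n.*2%:R) *: c al = \sum_i (q%:R - (al i).*2%:R) *: c al.
  have [<-|al_n] := eqVneq (total_degree al) n; last first.
    by rewrite hc // scaler0 big1 // => i _; rewrite scaler0.
  rewrite -scaler_suml big_split /= sumr_const card_ord mulnC natrM mulr_natr.
  by rewrite sumrN -muln2 /total_degree big_distrl /= natr_sum; under eq_bigr do rewrite muln2.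
transitivity (\sum_i \sum_j ((al i).+1 * (q - al i))%:R *:
    (if (0 < up i al j)%N then c (down j (up i al)) else 0)).
  by apply: eq_bigr => i _; rewrite ffunE scaler_sumr.
transitivity (\sum_i (\sum_j (if (0 < al j)%N then
    ((down j al i).+1 * (q - down j al i))%:R *: c (up i (down j al)) else 0)
    + (q%:R - (al i).*2%:R) *: c al)); last first.
  rewrite big_split /= exchange_big /=; congr (_ + _).
  by apply: eq_bigr => j _; rewrite ffunE; case: ifP => // _; rewrite big1.
apply: eq_bigr => i _; rewrite (bigD1 i) //= [X in _ = X + _](bigD1 i) //= addrAC.
congr (_ + _); last first.
  apply: eq_bigr => j ji; have ij : i != j by rewrite eq_sym.
  rewrite down_up // !downE ffunE (negbTE ji) (negbTE ij) subn0.
  by case: ifP => // _; rewrite scaler0.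
have castB : ((al i).+1 * (q - al i))%:R = (al i * (q - (al i).-1))%:R + (q%:R - (al i).*2%:R) :> K.
  have := ltn_ord (al i); rewrite ltnS; case: (al i : nat) => [|a] lt_aq.
    by rewrite mul1n mul0n subn0 double0 subr0 add0r.
  rewrite !natrM !natrB ?(ltnW lt_aq) // -muln2 natrM -!natr1.
  by move: (q%:R : K) (a%:R : K) => x y; ring.
have down_term : (if (0 < al i)%N then
    ((down i al i).+1 * (q - down i al i))%:R *: c (up i (down i al)) else 0)
    = (al i * (q - (al i).-1))%:R *: c al.
  rewrite downE eqxx subn1; case: posnP => [->|gt0]; first by rewrite scale0r.
  by rewrite downK // prednK.
rewrite down_term -scalerDl -castB; have [lt|ge] := boolP (al i < q)%N.
  by rewrite upE // eqxx /= upK.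
by move: ge; rewrite -leqNgt => /eqP->; rewrite muln0 !scale0r.
Qed.


Lemma raise_injective (X : V -> Prop) n m c : [pchar K] =i pred0 ->
  X 0 -> (forall k u v, X u -> X v -> X (k *: u + v)) ->
  homogeneous n c -> (n.*2 + m <= d * q)%N ->
  (forall be, X (iter m raise c be)) -> forall be, X (c be).
Proof.
move=> charK0 X0 XP; have Xsum (P : 'I_d -> V) : (forall i, X (P i)) -> X (\sum_i P i).
  by move=> XP'; apply: (big_ind X) => // u v Xu Xv; rewrite -[u]scale1r; apply: XP.
apply: (sl2_injective (X := fun e : {ffun box -> V} => forall be, X (e be))
  charK0 raise_linear homogeneous_raise homogeneous_lower lower0 _ _ _ _ lower_raise).
- by move=> be; rewrite ffunE.
- by move=> k u v Xu Xv be; rewrite !ffunE; apply: XP.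
- by move=> e Xe be; rewrite ffunE; apply: Xsum => i; case: ifP.
- move=> e Xe be; rewrite ffunE; apply: Xsum => i.
  by rewrite -[_ *: _]addr0; apply: XP.
Qed.

End Operators.
End Box.

(** * Ideals generated by powers of parameters *)

Section PowerIdeals.
Variables (K : fieldType) (A : comAlgType K) (d q : nat) (theta : 'I_d -> A).
Local Notation box := {ffun 'I_d -> 'I_q.+1}.
Implicit Types (e : 'I_d -> nat) (i : 'I_d) (a : A) (al be : box).

Definition power_ideal (P : pred 'I_d) e := ideal_gen [seq theta i ^+ e i | i <- enum P].
Definition monomial e : A := \prod_i theta i ^+ e i.

Local Notation mono al := (monomial (fun i => nat_of_ord (al i))).
Local Notation I := (power_ideal predT (fun=> 1%N)).
Local Notation J := (power_ideal predT (fun=> q.+1)).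

Lemma power_idealP (P : pred 'I_d) e a :
  reflect (exists c, a = \sum_(i | P i) c i * theta i ^+ e i) (a \in power_ideal P e).
Proof. exact: ideal_enumP. Qed.

Lemma mem_power_ideal (P : pred 'I_d) e i : P i -> theta i ^+ e i \in power_ideal P e.
Proof. by move=> Pi; apply: (ideal_family (fun i => theta i ^+ e i)). Qed.

Lemma power_ideal_sub (P Q : pred 'I_d) e e' :
  (forall i, P i -> Q i && (e' i <= e i)%N) ->
  {subset power_ideal P e <= power_ideal Q e'}.
Proof.
move=> PQ; apply: ideal_sub => x /mapP[i]; rewrite mem_enum => /PQ/andP[Qi le_e] ->.
by rewrite -(subnK le_e) exprD; apply/ideal_mull/mem_power_ideal.
Qed.

Lemma monomialD e e' : monomial (fun i => e i + e' i)%N = monomial e * monomial e'.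
Proof. by rewrite -big_split /=; apply: eq_bigr => i _; rewrite exprD. Qed.

Lemma eq_monomial e e' : e =1 e' -> monomial e = monomial e'.
Proof. by move=> ee'; apply: eq_bigr => i _; rewrite ee'. Qed.

Lemma theta_monomial e i : theta i * monomial e = monomial (fun k => (k == i) + e k)%N.
Proof.
rewrite monomialD; congr (_ * _); rewrite /monomial (bigD1 i) //= eqxx.
by rewrite big1 ?mulr1 // => k /negbTE->.
Qed.

Lemma monomial_power_ideal e i : (q < e i)%N -> monomial e \in J.
Proof.
move=> lt_qe; rewrite /monomial (bigD1 i) //= -(subnK lt_qe) exprD -mulrA.
exact/ideal_mull/ideal_mulr/(mem_power_ideal (fun=> q.+1)).
Qed.

(** Modulo [J], the multiplication by the sum of the [theta i] acts on the
   coefficients through [raise]. *)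
Lemma monomial_raise (c : {ffun box -> A}) :
  (\sum_i theta i) * (\sum_al c al * mono al) - \sum_be raise c be * mono be \in J.
Proof.
have -> : \sum_be raise c be * mono be =
    \sum_i \sum_(be : box | (0 < be i)%N) c (down i be) * mono be.
  rewrite (eq_bigr (fun be : box =>
    \sum_i (if (0 < be i)%N then c (down i be) * mono be else 0))) => [|be _].
    by rewrite exchange_big; apply: eq_bigr => i _; rewrite -big_mkcond.
  rewrite ffunE mulr_suml; apply: eq_bigr => i _.
  by case: ifP => // _; rewrite mul0r.
rewrite mulr_suml -sumrB; apply: ideal_sum => i _.
rewrite mulr_sumr (bigID (fun al : box => (al i < q)%N)) /=.
rewrite [X in _ - X](reindex_onto (up i) (down i)) /= => [|be]; last exact: downK.
rewrite [X in _ - X](eq_bigl (fun al : box => (al i < q)%N)) => [|al]; last first.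
  case lt: (al i < q)%N; first by rewrite upE // eqxx upK // eqxx.
  by rewrite up_max.
rewrite addrAC -sumrB big1 ?add0r => [|al lt]; last first.
  have -> : mono (up i al) = theta i * mono al.
    by rewrite theta_monomial; apply: eq_monomial => k; rewrite upE.
  by rewrite upK // mulrCA subrr.
apply: ideal_sum => al ge; rewrite mulrCA theta_monomial; apply: ideal_mull.
by apply: (@monomial_power_ideal _ i); rewrite eqxx; lia.
Qed.

Lemma monomial_iter_raise (c : {ffun box -> A}) m :
  (\sum_i theta i) ^+ m * (\sum_al c al * mono al)
    - \sum_be iter m (@raise d q K A) c be * mono be \in J.
Proof.
elim: m => [|m IHm]; first by rewrite mul1r subrr ideal0.
have := idealD (ideal_mull (\sum_i theta i) IHm) (monomial_raise (iter m (@raise d q K A) c)).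
by rewrite mulrBr mulrA -exprS addrA subrK.
Qed.

(** The elements of [I ^ n + J]: monomials outside the box are in [J]. *)
Definition adic n a := exists2 c : {ffun box -> A},
  homogeneous n c & a - \sum_al c al * mono al \in J.

Lemma adic_J n a : a \in J -> adic n a.
Proof.
exists 0 => [al _|]; first by rewrite ffunE.
by rewrite big1 ?subr0 // => al _; rewrite ffunE mul0r.
Qed.

Lemma adicD n a b : adic n a -> adic n b -> adic n (a + b).
Proof.
move=> [c hc aJ] [e he bJ]; exists (c + e).
  by move=> al al_n; rewrite ffunE hc // he // addr0.
under eq_bigr do rewrite ffunE mulrDl.
by rewrite big_split /= opprD addrACA; apply: idealD.
Qed.

Lemma adic_sum n T (s : seq T) (P : pred T) (F : T -> A) :
  (forall x, P x -> adic n (F x)) -> adic n (\sum_(x <- s | P x) F x).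
Proof.
move=> PF; apply: (big_ind (adic n)) => //; first by apply/adic_J/ideal0.
by move=> a b; apply: adicD.
Qed.

Lemma adic_monomial al a : adic (total_degree al) (a * mono al).
Proof.
exists [ffun be => if be == al then a else 0].
  by move=> be be_al; rewrite ffunE; case: eqP => // eq_be; rewrite eq_be eqxx in be_al.
rewrite (bigD1 al) //= ffunE eqxx big1 ?addr0 ?subrr ?ideal0 // => be /negbTE ne.
by rewrite ffunE ne mul0r.
Qed.

Lemma adic0 a : adic 0 a.
Proof.
have := adic_monomial [ffun=> ord0] a.
rewrite /total_degree big1 => [|i _]; last by rewrite ffunE.
rewrite (@eq_monomial _ (fun=> 0%N)) => [|i]; last by rewrite ffunE.
by rewrite /monomial big1 ?mulr1 // => i _; rewrite expr0.
Qed.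

Lemma adicS n a (c : {ffun box -> A}) : homogeneous n c ->
  a - \sum_al c al * mono al \in J -> (forall al, c al \in I) -> adic n.+1 a.
Proof.
move=> hc aJ cI; rewrite -[a](subrK (\sum_al c al * mono al)).
apply: adicD; first exact: adic_J.
apply: adic_sum => al _; have [al_n|al_n] := eqVneq (total_degree al) n; last first.
  by rewrite hc // mul0r; apply/adic_J/ideal0.
have /power_idealP[e ->] := cI al; rewrite mulr_suml; apply: adic_sum => i _.
rewrite expr1 -mulrA theta_monomial; have [lt|ge] := boolP (al i < q)%N.
  rewrite -al_n -(total_degree_up lt).
  have <- : mono (up i al) = monomial (fun k => (k == i) + al k)%N.
    by apply: eq_monomial => k; rewrite upE.
  exact: adic_monomial.
apply/adic_J/ideal_mull/(@monomial_power_ideal _ i); rewrite eqxx.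
by have := ltn_ord (al i); lia.
Qed.

Section ParameterSystem.
Variable t : seq A.
Hypotheses (t_reg : regular_seq t) (t_size : size t = d).
Hypothesis t_nil : {in t, forall y, exists n, y ^+ n \in I}.

(** Powers of parameters are parameters, so each [theta i] is regular modulo
   arbitrary powers of the others. *)
Lemma theta_regular e i : (forall k, 0 < e k)%N -> forall a,
  theta i * a \in power_ideal (predC1 i) e -> a \in power_ideal (predC1 i) e.
Proof.
move=> e_gt0; apply: (parameters_regular t_reg).
  rewrite size_map -cardE cardC1 card_ord t_size.
  by case: (d) i => [[]|].
move=> y /t_nil[n yn].
have [|m ynm] := @ideal_radical _ _ (theta i :: [seq theta i ^+ e i | i <- enum (predC1 i)]) _ _ yn.
  move=> x /mapP[k _ ->]; rewrite expr1.
  have [->|ki] := eqVneq k i; first by exists 1%N; apply/mem_ideal/mem_head.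
  exists (e k); apply: (ideal_subset _ (mem_power_ideal e (P := predC1 i) ki)).
  by move=> z zs; rewrite in_cons zs orbT.
by exists (n * m)%N; rewrite exprM.
Qed.

Lemma theta_power_regular e i n : (forall k, 0 < e k)%N -> forall a,
  theta i ^+ n * a \in power_ideal (predC1 i) e -> a \in power_ideal (predC1 i) e.
Proof.
move=> e_gt0 a; elim: n => [|n IHn]; first by rewrite mul1r.
by rewrite exprS -mulrA => /(theta_regular e_gt0)/IHn.
Qed.

(** The exponents are lowered to 1 one at a time: if theta^q * b lies in
   (theta ^ q.+1) + H with theta regular modulo H, then b lies in (theta) + H. *)
Lemma power_ideal_colon a : a * monomial (fun=> q) \in J -> a \in I.
Proof.
pose e (P : {set 'I_d}) i := if i \in P then q.+1 else 1%N.
have e_gt0 P i : (0 < e P i)%N by rewrite /e; case: ifP.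
suff colon n (P : {set 'I_d}) b : #|P| = n ->
    b * \prod_(i in P) theta i ^+ q \in power_ideal predT (e P) -> b \in I.
  move=> aJ; apply: (colon _ setT a erefl).
  rewrite (eq_bigl predT) => [|i]; last by rewrite inE.
  by apply: (power_ideal_sub _ aJ) => i _; rewrite /e in_setT /=.
elim: n P b => [|n IHn] P b.
  move=> /eqP; rewrite cards_eq0 => /eqP->; rewrite big_set0 mulr1.
  by apply: power_ideal_sub => i _; rewrite /e in_set0 /=.
move=> Pn; have /card_gt0P[i Pi] : (0 < #|P|)%N by rewrite Pn.
rewrite (big_setD1 i Pi) /= mulrCA => /power_idealP[c].
rewrite [X in _ = X](bigD1 i) //= {1}/e Pi => bE.
apply: (IHn (P :\ i)); first by apply/eqP; rewrite -eqSS -Pn (cardsD1 i P) Pi.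
set b' := b * _ in bE *.
have : theta i ^+ q * (b' - c i * theta i) \in power_ideal (predC1 i) (e P).
  rewrite mulrBr bE mulrCA -exprSr addrAC subrr add0r.
  by apply/power_idealP; exists c.
move=> /(theta_power_regular (e_gt0 P)) b'I.
rewrite -[b'](subrK (c i * theta i)); apply: idealD.
  by apply: (power_ideal_sub _ b'I) => k /= ki; rewrite /e in_setD1 ki leqnn.
apply: ideal_mull; have := mem_power_ideal (e (P :\ i)) (P := predT) (i := i) isT.
by rewrite {1}/e in_setD1 eqxx.
Qed.

(** Multiplying by the monomial complementary to [al] sends every other
   monomial of the same degree into the ideal. *)
Lemma leading_coefficients n (c : box -> A) :
  \sum_(al : box | total_degree al == n) c al * mono al \in J ->
  forall al, total_degree al = n -> c al \in I.
Proof.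
move=> cJ al al_n; apply: power_ideal_colon.
have := ideal_mulr (monomial (fun i => q - al i)%N) cJ.
rewrite (bigD1 al) ?al_n //= mulrDl -mulrA -monomialD.
rewrite (@eq_monomial _ (fun=> q)) => [|i]; last first.
  by rewrite subnKC // -ltnS ltn_ord.
rewrite idealDr // mulr_suml; apply: ideal_sum => be /andP[/eqP be_n be_al].
rewrite -mulrA -monomialD; apply: ideal_mull.
have [i lt_i] : exists i, (al i < be i)%N.
  apply/existsP; apply: contraT; rewrite negb_exists => /forallP le_be.
  have := be_n; rewrite -al_n /total_degree => /eqP.
  have le k : (be k <= al k)%N by rewrite leqNgt.
  have := leqif_sum (P := predT) (fun k _ => leqif_eq (le k)).
  move=> /leqifP; case: ifP => [/forallP eq_be _ _|_ lt /eqP eq_be].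
    by case/eqP: be_al; apply/ffunP => k; apply/val_inj/eqP/(implyP (eq_be k)).
  by rewrite eq_be ltnn in lt.
by apply: (@monomial_power_ideal _ i); have := ltn_ord (al i); lia.
Qed.

Hypothesis charK0 : [pchar K] =i pred0.

(** Climbing the filtration: the leading form of [a] in degree [n] is killed by
   the [m]-th power of the sum of the variables, so it vanishes. *)
Lemma lefschetz_adic n m a : (n.*2 + m <= d * q)%N ->
  (\sum_i theta i) ^+ m * a \in J -> adic n.+1 a.
Proof.
move=> le_dq aJ; have step k : (k.*2 + m <= d * q)%N -> adic k a -> adic k.+1 a.
  move=> le_k [c hc ac]; apply: (adicS hc ac).
  apply: (raise_injective (X := fun x => x \in I) charK0 _ _ hc le_k).
  - exact: ideal0.
  - by move=> x u v uI vI; rewrite -[u]mul1r scalerAl; apply: idealD => //; apply: ideal_mull.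
  have hcm : homogeneous (k + m) (iter m (@raise d q K A) c).
    by apply: (wt_iter _ _ hc); apply: homogeneous_raise.
  move=> be; have [be_km|be_km] := eqVneq (total_degree be) (k + m)%N; last first.
    by rewrite hcm ?ideal0.
  apply: (leading_coefficients _ be_km).
  have := idealB aJ (idealD (ideal_mull ((\sum_i theta i) ^+ m) ac) (monomial_iter_raise c m)).
  rewrite mulrBr addrA subrK opprB addrCA subrr addr0.
  rewrite (bigID (fun al : box => total_degree al == (k + m)%N)) /= [X in _ + X]big1 ?addr0 //.
  by move=> al al_km; rewrite hcm ?mul0r.
elim: n le_dq => [|n IHn] le_dq; apply: step => //; first exact: adic0.
by apply: IHn; lia.
Qed.

End ParameterSystem.

End PowerIdeals.

(** * Homogeneous components *)

Section Components.
Variables (K : fieldType) (A : gradedAlg K).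
Implicit Types (a b : A).

Fact component_exists a : exists f : nat -> A,
  (forall i, f i \in piece A i) /\ exists n, a = \sum_(i < n) f i /\
  forall i, (n <= i)%N -> f i = 0.
Proof.
have [n [f [Af ->]]] := grading_span (pieceP A) a.
exists (fun i => if (i < n)%N then f i else 0); split=> [i|].
  by case: ifP => _; rewrite ?piece0.
exists n; split=> [|i]; last by rewrite leqNgt; case: ifP.
by apply: eq_bigr => i _; rewrite ltn_ord.
Qed.

Definition component n a : A := projT1 (cid (component_exists a)) n.

Lemma component_piece n a : component n a \in piece A n.
Proof. by rewrite /component; case: cid => f []. Qed.

Lemma component_sum a : exists n, a = \sum_(i < n) component i a /\
  forall i, (n <= i)%N -> component i a = 0.
Proof. by rewrite /component; case: cid => f []. Qed.

Lemma component_uniq (f : nat -> A) n i : (forall i, f i \in piece A i) ->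
  component i (\sum_(j < n) f j) = if (i < n)%N then f i else 0.
Proof.
move=> Af; have [m [aE a0]] := component_sum (\sum_(j < n) f j).
have := piece_uniq Af (fun i => component_piece i _) aE i => ->.
by case: ltnP => // /a0.
Qed.

Fact component_linear n : linear (component n).
Proof.
move=> k a b; have [m1 [aE a0]] := component_sum a; have [m2 [bE b0]] := component_sum b.
pose m := maxn m1 m2.
have extend c l : c = \sum_(i < l) component i c ->
    (forall i, (l <= i)%N -> component i c = 0) -> (l <= m)%N -> c = \sum_(i < m) component i c.
  move=> cE c0 le_lm; rewrite [LHS]cE (@sum_trunc A l m (fun i => component i c) le_lm).
  by apply: eq_bigr => i _; case: ltnP => // /c0.
have a_m : (m <= n)%N -> component n a = 0.
  by move=> le_mn; apply/a0/(leq_trans _ le_mn)/leq_maxl.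
have b_m : (m <= n)%N -> component n b = 0.
  by move=> le_mn; apply/b0/(leq_trans _ le_mn)/leq_maxr.
rewrite {1}(extend a m1) ?leq_maxl // {1}(extend b m2) ?leq_maxr //.
rewrite scaler_sumr -big_split /=.
rewrite (component_uniq (f := fun i => k *: component i a + component i b)) => [|i].
  by case: ltnP => // le_mn; rewrite a_m // b_m // scaler0 addr0.
by rewrite pieceZD ?component_piece.
Qed.

HB.instance Definition _ n := GRing.isLinear.Build K A A *:%R (component n)
  (component_linear n).

Lemma component_piece_id m n a : a \in piece A m ->
  component n a = if n == m then a else 0.
Proof.
move=> am; pose f i := if i == m then a else 0.
have Af i : f i \in piece A i by rewrite /f; case: eqP => [->|]; rewrite ?piece0.
have aE : a = \sum_(i < m.+1) f i.
  by rewrite big_ord_recr /= /f eqxx big1 ?add0r // => i _; rewrite ltn_eqF.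
rewrite [in LHS]aE component_uniq // /f ltnS.
by case: eqP => [->|_]; rewrite ?leqnn // if_same.
Qed.

Lemma componentM m n a b : b \in piece A m ->
  component n (a * b) = if (m <= n)%N then component (n - m) a * b else 0.
Proof.
move=> bm; have [l [aE a0]] := component_sum a.
rewrite [in LHS]aE mulr_suml linear_sum /=.
under eq_bigr => i _ do rewrite (@component_piece_id (i + m))
  ?(grading_mul (pieceP A)) ?component_piece //.
case: leqP => [le_mn|lt_nm]; last first.
  by rewrite big1 // => i _; case: eqP => // n_im; lia.
have [lt_l|le_l] := ltnP (n - m) l; last first.
  rewrite a0 // mul0r big1 // => i _; case: eqP => // n_im.
  by have := ltn_ord i; lia.
rewrite (bigD1 (Ordinal lt_l)) //= subnK // eqxx big1 ?addr0 // => i i_n.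
by case: eqP => // n_im; case/eqP: i_n; apply/val_inj; rewrite /= n_im addnK.
Qed.

End Components.

Section GradedParameters.
Variables (K : fieldType) (A : gradedAlg K) (d : nat) (theta : 'I_d -> A).
Hypothesis theta1 : forall i, theta i \in piece A 1.
Implicit Types (a : A).

Lemma monomial_piece e : monomial theta e \in piece A (\sum_i e i).
Proof.
rewrite /monomial; apply: (big_ind2 (fun (n : nat) b => b \in piece A n)).
- exact: grading_one (pieceP A).
- by move=> n1 b1 n2 b2; apply: (grading_mul (pieceP A)).
- by move=> i _; have := pieceX (e i) (theta1 i); rewrite mul1n.
Qed.

(** Homogeneous elements of an ideal generated by homogeneous elements have
   homogeneous coefficients; generators of too high a degree disappear. *)
Lemma component_power_ideal n (P : pred 'I_d) e a : a \in power_ideal theta P e ->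
  exists2 c, forall i, c i \in piece A (n - e i) &
    component n a = \sum_(i | P i && (e i <= n)%N) c i * theta i ^+ e i.
Proof.
case/power_idealP => c ->; exists (fun i => component (n - e i) (c i)).
  by move=> i; apply: component_piece.
rewrite linear_sum big_mkcondr; apply: eq_bigr => i _ /=.
by rewrite (componentM (m := e i)) // -[X in piece A X]mul1n pieceX.
Qed.

Lemma component_mem n (P : pred 'I_d) e a :
  a \in power_ideal theta P e -> component n a \in power_ideal theta P e.
Proof.
case/(component_power_ideal n) => c _ ->; apply: ideal_sum => i /andP[Pi _].
exact/ideal_mull/mem_power_ideal.
Qed.

Section Box.
Variable q : nat.
Local Notation J := (power_ideal theta predT (fun=> q.+1)).
Local Notation mono al := (monomial theta (fun i => nat_of_ord (al i))).

Lemma adic_component n m a : adic q theta m a -> (m <= n)%N ->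
  exists2 c : {ffun {ffun 'I_d -> 'I_q.+1} -> A},
    homogeneous m c /\ forall al, c al \in piece A (n - m) &
    component n a - \sum_al c al * mono al \in J.
Proof.
move=> [c hc ac] le_mn; exists [ffun al => component (n - m) (c al)].
  split=> [al al_m|al]; rewrite ffunE ?component_piece //.
  by rewrite hc // linear0.
have := component_mem n ac; rewrite linearB linear_sum /=.
congr (_ - _ \in J); apply: eq_bigr => al _.
rewrite (componentM (m := total_degree al)) ?monomial_piece // ffunE.
have [->|al_m] := eqVneq (total_degree al) m; first by rewrite le_mn.
by rewrite hc // !linear0 mul0r if_same.
Qed.

Lemma adic_piece n m a : a \in piece A n -> (n < m)%N -> adic q theta m a -> a \in J.
Proof.
move=> an lt_nm [c hc] /(component_mem n); rewrite linearB linear_sum /=.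
rewrite (component_piece_id _ an) eqxx big1 ?subr0 // => al _.
rewrite (componentM (m := total_degree al)) ?monomial_piece //.
have [->|al_m] := eqVneq (total_degree al) m; first by rewrite leqNgt lt_nm.
by rewrite hc // linear0 mul0r if_same.
Qed.

(** In degree at least [n0 + d * q] the coefficients of the leading forms have degree
   at least [n0], so the filtration can be climbed up to degree [d * q + 1], where the
   box contains no monomial. *)
Lemma piece_power_ideal n0 n a :
  (forall k b, (n0 <= k)%N -> b \in piece A k -> b \in power_ideal theta predT (fun=> 1%N)) ->
  a \in piece A n -> (n0 + d * q <= n)%N -> a \in J.
Proof.
move=> n0P an le_n; have step m : (m <= d * q)%N -> adic q theta m a -> adic q theta m.+1 a.
  move=> le_m /adic_component/(_ (leq_trans le_m (leq_trans (leq_addl _ _) le_n))).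
  rewrite (component_piece_id _ an) eqxx => -[c [hc cP] ac].
  by apply: (adicS hc ac) => al; apply: n0P (cP al); lia.
have: adic q theta (d * q).+1 a.
  suff: forall m, (m <= (d * q).+1)%N -> adic q theta m a by apply.
  by elim=> [|m IHm] le_m; [exact: adic0|apply/step/IHm/ltnW].
case=> c hc; rewrite big1 ?subr0 // => al _; rewrite hc ?mul0r //.
rewrite neq_ltn ltnS /total_degree; apply/orP; left.
apply: (@leq_trans (\sum_(i < d) q)%N); last by rewrite sum_nat_const card_ord.
by apply: leq_sum => i _; rewrite -ltnS ltn_ord.
Qed.

End Box.
End GradedParameters.

(** * Hilbert functions *)

Lemma finite_dim_pieces (K : fieldType) (B : gradedAlg K) k : @has_dim K B predT k ->
  exists n0, forall n b, (n0 <= n)%N -> b \in piece B n -> b = 0.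
Proof.
move=> [e [_ eP]].
have /choice[N NP] : forall i, exists n, forall m, (n <= m)%N -> component m (e i) = 0.
  by move=> i; have [n [_ ?]] := component_sum (e i); exists n.
exists (\max_i N i)%N => n b le_n bn.
rewrite -[b](_ : component n b = b); last by rewrite (component_piece_id n bn) eqxx.
have [c [-> _]] := eP b isT; rewrite linear_sum big1 // => i _.
by rewrite linearZ_LR /= NP ?scaler0 // (leq_trans _ le_n) // leq_bigmax.
Qed.

Lemma subspace_exists (K : fieldType) (V : vectType K) (S : V -> Prop) :
  S 0 -> (forall k u v, S u -> S v -> S (k *: u + v)) ->
  exists U : {vspace V}, forall v, v \in U <-> S v.
Proof.
move=> S0 SP; pose P m := `[< exists2 U : {vspace V}, forall v, v \in U -> S v & \dim U = m >].
have exP : exists m, P m.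
  by exists 0%N; apply/asboolP; exists 0%VS; rewrite ?dimv0 // => v; rewrite memv0 => /eqP->.
have leP m : P m -> (m <= \dim {:V})%N by move=> /asboolP[U _ <-]; apply/dimvS/subvf.
have [m /asboolP[U US Um] maxU] := ex_maxnP exP leP.
exists U => v; split=> [/US//|Sv]; apply: contraT => Uv.
have/asboolP/maxU : exists2 U' : {vspace V}, forall v, v \in U' -> S v & \dim U' = m.+1.
  exists (U + <[v]>)%VS.
    move=> x /memv_addP[u uU [_ /vlineP[k ->] ->]]; rewrite addrC.
    by apply: SP => //; apply: US.
  rewrite dimv_disjoint_sum; last first.
    apply/eqP; rewrite -subv0; apply/subvP => x /memv_capP[xU /vlineP[k xk]].
    rewrite memv0 xk; have [->|k0] := eqVneq k 0; first by rewrite scale0r.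
    by move: xU; rewrite xk rpredZeq (negbTE k0) (negbTE Uv).
  rewrite Um dim_vline; case: eqP => [v0|_]; last by rewrite addn1.
  by rewrite v0 mem0v in Uv.
by rewrite ltnn.
Qed.

(** The exact sequence 0 -> V/U -> W/X -> W/(X + L V) -> 0. *)
Lemma dim_exact (K : fieldType) (V W : vectType K) (L : 'Hom(V, W))
    (U : {vspace V}) (X : {vspace W}) :
  (forall v, (L v \in X) = (v \in U)) ->
  (\dim (X + limg L) + \dim U = \dim X + \dim {:V})%N.
Proof.
move=> LU; have kerU : (lker L <= U)%VS.
  by apply/subvP => v; rewrite memv_ker -LU => /eqP->; apply: mem0v.
have imgU : (L @: U = X :&: limg L)%VS.
  apply/eqP; rewrite eqEsubv; apply/andP; split; apply/subvP => w.
    by move=> /memv_imgP[v vU ->]; rewrite memv_cap LU vU memv_img ?memvf.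
  by move=> /memv_capP[wX /memv_imgP[v _ wv]]; rewrite wv memv_img // -LU -wv.
have := limg_ker_dim L U; rewrite (capv_idPr kerU) imgU.
have := limg_ker_dim L fullv; rewrite capfv.
have := dimv_sum_cap X (limg L).
lia.
Qed.

Section Hilbert.
Variables (K : fieldType) (A : gradedAlg K) (d : nat) (theta : 'I_d -> A) (t : seq A).
Hypothesis theta1 : forall i, theta i \in piece A 1.
Hypotheses (t_reg : regular_seq t) (t_size : size t = d).
Hypothesis t_nil :
  {in t, forall y, exists n, y ^+ n \in power_ideal theta predT (fun=> 1%N)}.

Definition prefix_ideal k := power_ideal theta (fun i : 'I_d => (i < k)%N) (fun=> 1%N).

Lemma mem_prefix_ideal k (i : 'I_d) : (i < k)%N -> theta i \in prefix_ideal k.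
Proof.
move=> lt_ik; rewrite -[theta i]expr1.
exact: (mem_power_ideal theta (fun=> 1%N) (P := fun j : 'I_d => (j < k)%N)).
Qed.

(** In degree [n], adding the powers [theta j ^+ n.+1] to an ideal does not
   change it: so [theta i] is regular modulo the previous ones because it is
   regular modulo the previous ones and high powers of the next ones. *)
Lemma prefix_regular (i : 'I_d) n a : a \in piece A n ->
  theta i * a \in prefix_ideal i -> a \in prefix_ideal i.
Proof.
move=> an; pose e (j : 'I_d) := if (j < i)%N then 1%N else n.+1.
have e_gt0 j : (0 < e j)%N by rewrite /e; case: ifP.
move=> aI; have: a \in power_ideal theta (predC1 i) e.
  apply: (theta_regular t_reg t_size t_nil e_gt0); apply: (power_ideal_sub _ aI).
  by move=> j ji; rewrite /e ji /= andbT; apply: contraTneq ji => ->; rewrite ltnn.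
move=> /(component_power_ideal theta1 n)[c _].
rewrite (component_piece_id n an) eqxx => ->; apply: ideal_sum => j /andP[ji].
rewrite /e; case: ifP => [lt_ji _|]; last by rewrite ltnn.
by rewrite expr1; apply/ideal_mull/mem_prefix_ideal.
Qed.

Variable H : nat -> nat.
Hypothesis HP : forall n, has_dim (piece A n) (H n).

Let basis n : 'I_(H n) -> A := projT1 (cid (HP n)).

Definition of_coordinates n (v : 'rV[K]_(H n)) : A := \sum_i v 0 i *: basis i.

Lemma of_coordinates_linear n : linear (@of_coordinates n).
Proof.
move=> k u v; rewrite /of_coordinates scaler_sumr -big_split /=.
by apply: eq_bigr => i _; rewrite !mxE scalerDl scalerA.
Qed.

HB.instance Definition _ n := GRing.isLinear.Build K 'rV[K]_(H n) A *:%R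
  (@of_coordinates n) (@of_coordinates_linear n).

Lemma of_coordinates_piece n (v : 'rV[K]_(H n)) : of_coordinates v \in piece A n.
Proof.
have [eA _] := projT2 (cid (HP n)); rewrite /of_coordinates.
apply: (big_ind [in piece A n]); first exact: piece0.
  by move=> a b; apply: pieceD.
by move=> i _; apply/pieceZ/eA.
Qed.

Lemma of_coordinates_surj n a : a \in piece A n -> exists v : 'rV[K]_(H n), a = of_coordinates v.
Proof.
move=> an; have [_ /(_ a an)[c [-> _]]] := projT2 (cid (HP n)).
by exists (\row_i c i); apply: eq_bigr => i _; rewrite mxE.
Qed.

Lemma of_coordinates_inj n : injective (@of_coordinates n).
Proof.
move=> u v uv; have [_ /(_ _ (of_coordinates_piece u))[c [_ cU]]] := projT2 (cid (HP n)).
have coords (w : 'rV[K]_(H n)) : of_coordinates u = of_coordinates w ->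
    c = [ffun i => w 0 i].
  by move=> uw; apply: cU; rewrite uw; apply: eq_bigr => i _; rewrite ffunE.
apply/rowP => i; have := coords u erefl; rewrite (coords v uv) => /ffunP/(_ i).
by rewrite !ffunE.
Qed.

Fact prefix_space_exists k n : exists U : {vspace 'rV[K]_(H n)},
  forall v, v \in U <-> of_coordinates v \in prefix_ideal k.
Proof.
apply: subspace_exists => [|x u v uI vI].
  by rewrite linear0 ideal0.
rewrite linearP; apply: idealD => //.
by have := ideal_mull x%:A uI; rewrite -scalerAl mul1r.
Qed.

Definition prefix_space k n : {vspace 'rV[K]_(H n)} := projT1 (cid (prefix_space_exists k n)).

Lemma prefix_spaceP k n v : v \in prefix_space k n = (of_coordinates v \in prefix_ideal k).
Proof. by rewrite /prefix_space; case: cid => U UP; apply/idP/idP => /UP. Qed.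

Lemma prefix_ideal_dim (i : 'I_d) n :
  (\dim (prefix_space i.+1 n.+1) + \dim (prefix_space i n) =
     \dim (prefix_space i n.+1) + H n)%N.
Proof.
have /choice[f fP] : forall j : 'I_(H n), exists w : 'rV[K]_(H n.+1),
    theta i * basis j = of_coordinates w.
  move=> j; apply: of_coordinates_surj.
  have [eA _] := projT2 (cid (HP n)).
  exact: (grading_mul (pieceP A) (theta1 i) (eA j)).
pose L : 'Hom('rV[K]_(H n), 'rV[K]_(H n.+1)) := linfun (mulmxr (\matrix_j f j)).
have LP v : of_coordinates (L v) = theta i * of_coordinates v.
  rewrite lfunE /= mulmx_sum_row linear_sum [in RHS]/of_coordinates mulr_sumr.
  by apply: eq_bigr => j _; rewrite linearZ_LR /= rowK -fP scalerAr.
have <- : (prefix_space i n.+1 + limg L)%VS = prefix_space i.+1 n.+1.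
  apply/eqP; rewrite eqEsubv; apply/andP; split; apply/subvP => v.
    move=> /memv_addP[x xX [_ /memv_imgP[u _ ->] ->]].
    rewrite prefix_spaceP linearD /= LP; apply: idealD; last exact/ideal_mulr/mem_prefix_ideal.
    rewrite prefix_spaceP in xX; apply: (power_ideal_sub _ xX) => j lt_ji.
    by rewrite ltnS ltnW.
  rewrite prefix_spaceP => /(component_power_ideal theta1 n.+1)[c cn].
  rewrite (component_piece_id _ (of_coordinates_piece v)) eqxx (bigD1 i) /= ?ltnSn // expr1.
  have [|u uE] := @of_coordinates_surj n (c i); first by have := cn i; rewrite subn1.
  move=> vE; rewrite -[v](subrK (L u)) memv_add ?memv_img ?memvf //.
  rewrite prefix_spaceP linearB /= LP vE -uE mulrC addrAC subrr add0r.
  apply: ideal_sum => j /andP[/andP[le_ji _] ji]; rewrite expr1.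
  by apply/ideal_mull/mem_prefix_ideal; rewrite ltn_neqAle -ltnS le_ji andbT.
rewrite (@dim_exact _ _ _ L) => [|v]; first by rewrite dimvf dim_matrix mul1r.
rewrite !prefix_spaceP LP; apply/idP/idP => [|vI]; last exact: ideal_mull.
exact/prefix_regular/of_coordinates_piece.
Qed.

Lemma prefix_space_eq0 k n : k = 0%N \/ n = 0%N -> prefix_space k n = 0%VS.
Proof.
move=> kn; apply/eqP; rewrite -subv0; apply/subvP => v; rewrite memv0 prefix_spaceP.
move=> /(component_power_ideal theta1 n)[c _].
rewrite (component_piece_id _ (of_coordinates_piece v)) eqxx big1 => [v0|j /andP[lt_jk lt_0n]].
  by apply/eqP/of_coordinates_inj; rewrite linear0.
by case: kn lt_jk lt_0n => ->.
Qed.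

(** Adjoining a regular linear form multiplies the Hilbert series by 1 - t. *)
Lemma prefix_codim k n : (k <= d)%N ->
  (H n)%:Z - (\dim (prefix_space k n))%:Z =
    \sum_(i < n.+1) (H i)%:Z * ((1 - 'X) ^+ k : {poly int})`_(n - i).
Proof.
elim: k n => [|k IHk] n le_kd.
  rewrite prefix_space_eq0; last by left.
  rewrite dimv0 subr0 big_ord_recr /= subnn coef1 mulr1 big1 ?add0r // => i _.
  by rewrite coef1 subn_eq0 leqNgt ltn_ord mulr0.
have coefS m : ((1 - 'X) ^+ k.+1 : {poly int})`_m =
    ((1 - 'X) ^+ k)`_m - (if m is m'.+1 then ((1 - 'X) ^+ k)`_m' else 0).
  by rewrite exprSr mulrBr mulr1 coefB coefMX; case: m.
case: n => [|n].
  have -> : prefix_space k.+1 0 = prefix_space k 0 by rewrite !prefix_space_eq0 //; right.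
  by rewrite (IHk 0%N (ltnW le_kd)) !big_ord1 coefS subr0.
have -> : (H n.+1)%:Z - (\dim (prefix_space k.+1 n.+1))%:Z =
    ((H n.+1)%:Z - (\dim (prefix_space k n.+1))%:Z) - ((H n)%:Z - (\dim (prefix_space k n))%:Z).
  have := prefix_ideal_dim (Ordinal le_kd) n; rewrite /=.
  by lia.
rewrite !IHk 1?ltnW //; under [RHS]eq_bigr do rewrite coefS mulrBr.
rewrite sumrB [X in _ = _ - X]big_ord_recr /= subnn mulr0 addr0; congr (_ - _).
by apply: eq_bigr => i _; rewrite subSn // -ltnS ltn_ord.
Qed.

(** The h-polynomial is the Hilbert series of the quotient by all the [theta i]. *)
Lemma h_vanishing (h : {poly int}) :
  (forall n, h`_n = \sum_(i < n.+1) (H i)%:Z * ((1 - 'X) ^+ d : {poly int})`_(n - i)) ->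
  forall n a, (size h <= n)%N -> a \in piece A n -> a \in power_ideal theta predT (fun=> 1%N).
Proof.
move=> hP n a le_hn /of_coordinates_surj[v ->].
have := prefix_codim n (leqnn d); rewrite -hP nth_default // => /eqP.
rewrite subr_eq0 eqz_nat eq_sym => /eqP dimU.
have: v \in prefix_space d n.
  suff -> : prefix_space d n = fullv by apply: memvf.
  by apply/eqP; rewrite eqEdim subvf dimvf dim_matrix mul1r dimU /=.
by rewrite prefix_spaceP; apply: power_ideal_sub => i _.
Qed.

End Hilbert.

(** * The Veronese quotient *)

Lemma form_idealP (K : fieldType) (B : gradedAlg K) d (s : d.-tuple (linear_form B)) (b : B) :
  reflect (exists c, b = \sum_i c i * val (tnth s i)) (b \in form_ideal s).
Proof.
rewrite /form_ideal -[s in map _ s]map_tnth_enum -map_comp.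
apply: (iffP (ideal_mapP _ _ (enum_uniq _))) => -[c ->]; exists c; by rewrite big_enum.
Qed.

Lemma krull_dim_uniq (R : comNzRingType) m n : krull_dim R m -> krull_dim R n -> m = n.
Proof. by move=> [cm lem] [cn len]; apply/eqP; rewrite eqn_leq len ?lem. Qed.

Section VeroneseQuotient.
Variables (K : fieldType) (A : gradedAlg K) (d : nat).
Variables (Theta : d.-tuple (linear_form A)) (q : nat).
Let r_gt0 := ltn0Sn q.
Let theta i := val (tnth Theta i).
Let V := veronese A r_gt0.
Let forms := [seq veronese_power r_gt0 x | x <- Theta].
Local Notation I := (power_ideal theta predT (fun=> 1%N)).
Local Notation J := (power_ideal theta predT (fun=> q.+1)).

Lemma theta_piece i : theta i \in piece A 1.
Proof. exact: valP. Qed.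

Lemma form_ideal_theta : form_ideal Theta =i I.
Proof.
move=> a; apply/form_idealP/power_idealP => -[c ->]; exists c;
  by apply: eq_bigr => i _; rewrite expr1.
Qed.

Lemma val_form_ideal (u : V) : u \in form_ideal forms -> val u \in J.
Proof.
move=> /(@form_idealP K V d [tuple of forms] _)[c ->]; rewrite rmorph_sum.
apply: ideal_sum => i _; rewrite rmorphM /= tnth_map; apply: ideal_mull.
exact: (mem_power_ideal theta (fun=> q.+1)).
Qed.

(** Homogeneous coefficients have degree [(n - 1) * q.+1], so they lie in the Veronese
   subalgebra. *)
Lemma veronese_form_ideal n (u : V) : u \in piece V n -> val u \in J -> u \in form_ideal forms.
Proof.
move=> un; have vun : val u \in piece A (n * q.+1) := un.
move=> /(component_power_ideal theta_piece (n * q.+1))[c cP].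
rewrite (component_piece_id _ vun) eqxx => uE; apply/(@form_idealP K V d [tuple of forms] _).
have Vc i : (if (q.+1 <= n * q.+1)%N then c i else 0) \in @veronese_pred K A q.+1.
  case: ifP => _; last by rewrite rpred0.
  apply/asboolP; apply: (@in_sum1 _ _ _ n.-1) => [j|]; first exact: piece0.
  by have := cP i; rewrite -{2}[q.+1]mul1n -mulnBl subn1.
(* For [n = 0] the ideal has no element of degree [n] but 0, and the truncated degree of
   [c i] is meaningless. *)
exists (fun i => Sub (if (q.+1 <= n * q.+1)%N then c i else 0) (Vc i) : V).
apply: val_inj; rewrite uE rmorph_sum /=.
rewrite big_mkcond; apply: eq_bigr => i _; rewrite tnth_map SubK /=.
by case: ifP => //; rewrite mul0r.
Qed.

Section ParameterSystem.
Hypothesis charK0 : [pchar K] =i pred0.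
Variable t : seq A.
Hypotheses (t_reg : regular_seq t) (t_size : size t = d).
Hypothesis t_nil : {in t, forall y, exists n, y ^+ n \in I}.

Local Notation B := (veronese_quot Theta r_gt0).

Lemma veronese_lefschetz k : (k * q.+1 <= d * q)%N -> lefschetz B k.
Proof.
move=> le_k; pose w := \sum_i theta i.
have w1 : w \in piece A 1.
  by apply: (big_ind [in piece A 1]); [exact: piece0|exact: pieceD|move=> i _; exact: theta_piece].
have Vw : w ^+ q.+1 \in @veronese_pred K A q.+1.
  apply/asboolP; apply: (@in_sum1 _ _ _ 1%N) => [j|]; [exact: piece0|exact: pieceX].
pose W : V := Sub (w ^+ q.+1) Vw.
have vW n (u : V) : val (W ^+ n * u) = w ^+ (q.+1 * n) * val u.
  by rewrite rmorphM rmorphXn exprM.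
exists (qproj (form_ideal forms) W).
  by apply/asboolP; exists W => //; exact: (pieceX q.+1 w1).
move=> k_gt0 i le_i x y Bx By /= xy; apply/eqP; rewrite -subr_eq0; apply/eqP.
have := pieceB Bx By; set z := x - y => /asboolP[u ui zE].
apply/eqP; rewrite zE qproj_eq0; apply: (veronese_form_ideal ui).
have : W ^+ (k - 2 * i) * u \in form_ideal forms.
  by rewrite -qproj_eq0 rmorphM rmorphXn /= -zE mulrBr xy subrr.
move=> /val_form_ideal; rewrite vW => uJ.
apply: (adic_piece theta_piece (n := (i * q.+1)%N) ui (ltnSn _)).
apply: (lefschetz_adic t_reg t_size t_nil charK0) uJ.
apply: leq_trans le_k; rewrite -addnn [(q.+1 * _)%N]mulnC -!mulnDl leq_mul2r; lia.
Qed.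

Lemma veronese_almost_strong (H : nat -> nat) (h : {poly int}) :
  (forall n, has_dim (piece A n) (H n)) ->
  (forall n, h`_n = \sum_(i < n.+1) (H i)%:Z * ((1 - 'X) ^+ d : {poly int})`_(n - i)) ->
  ((size h).-1 <= q.+1)%N -> almost_strong_lefschetz B.
Proof.
move=> HP hP le_h; pose s := ((d * q) %/ q.+1)%N.
(* [s.+2 * q.+1] exceeds [d * q + q.+1], and pieces of degree at least [q.+2] lie in [I]. *)
have B0 i b : (s.+1 < i)%N -> b \in piece B i -> b = 0.
  move=> lt_i /asboolP[u ui ->]; apply/eqP; rewrite qproj_eq0.
  apply: (veronese_form_ideal ui).
  apply: (piece_power_ideal theta_piece (n0 := q.+2) (n := (i * q.+1)%N) _ ui).
    move=> k a le_k; apply: (h_vanishing theta_piece t_reg t_size t_nil HP hP).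
    by apply: leq_trans le_k; case: (size h) le_h.
  have := leq_mul lt_i (leqnn q.+1); have := ltn_ceil (d * q) (ltn0Sn q); rewrite -/s.
  by rewrite [(s.+2 * _)%N]mulSn; lia.
pose P i := `[< exists2 b, b \in piece B i & b != 0 >].
have exP : exists i, P i.
  by exists 0%N; apply/asboolP; exists 1; [exact: grading_one (pieceP B)|exact: oner_neq0].
have leP i : P i -> (i <= s.+1)%N.
  move=> /asboolP[b bi b0]; rewrite leqNgt; apply: contraNN b0 => lt_i.
  by apply/eqP/(B0 i).
have [sigma /asboolP Psigma maxsigma] := ex_maxnP exP leP.
exists sigma; first split=> // i lt_i b bi.
  apply/eqP; apply: contraTT lt_i => b0; rewrite -leqNgt; apply: maxsigma.
  by apply/asboolP; exists b.
apply: veronese_lefschetz; apply: leq_trans (leq_trunc_div (d * q) q.+1).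
by rewrite leq_mul2r /= leq_subLR add1n; apply: leP; apply/asboolP.
Qed.

End ParameterSystem.
End VeroneseQuotient.

Theorem theorem1p1 (K : fieldType) (charK0 : [pchar K] =i pred0)
    (A : gradedAlg K) (stdA : standard_graded A) (cmA : cohen_macaulay A)
    (d : nat) (dimA : krull_dim A d)
    (Theta : d.-tuple (linear_form A)) (lsopTheta : is_lsop Theta)
    (r : nat) (r_gt0 : (0 < r)%N) :
  lefschetz (veronese_quot Theta r_gt0) (((r - 1) * d) %/ r) /\
  (forall h : {poly int}, is_h_polynomial A h -> ((size h).-1 <= r)%N ->
     almost_strong_lefschetz (veronese_quot Theta r_gt0)).
Proof.
case: r r_gt0 => // q r_gt0; rewrite (bool_irrelevance r_gt0 (ltn0Sn q)) subn1 /= mulnC.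
have [n /(krull_dim_uniq dimA) <-] := cmA; case=> -[t [t_hom t_reg] t_size] _.
have [_ [k /finite_dim_pieces[n0 n0P]]] := lsopTheta.
have t_nil : {in t, forall y, exists n,
    y ^+ n \in power_ideal (fun i => val (tnth Theta i)) predT (fun=> 1%N)}.
  move=> y /t_hom[e /andP[e_gt0 ye]]; exists n0.
  rewrite -form_ideal_theta -qproj_eq0; apply/eqP/(n0P (e * n0)%N).
    exact: leq_pmull.
  by apply/asboolP; exists (y ^+ n0) => //; apply: pieceX.
split; first by apply: (veronese_lefschetz charK0 t_reg t_size t_nil); apply: leq_trunc_div.
move=> h [d' [H [/(krull_dim_uniq dimA) <- HP hP]]].
exact: (veronese_almost_strong charK0 t_reg t_size t_nil HP hP).
Qed.
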